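(* Let $G,H,K$ be finite groups, $\Bbbk$ a commutative ring, $X'\le X\le G\times H$ and $Y'\le Y\le H\times K$ subgroups, $M$ a left $\Bbbk X'$-module and $N$ a left $\Bbbk Y'$-module. Then one has an isomorphism of $\Bbbk[X*Y]$-modules $$\mathrm{Ind}_{X'}^X(M)\overset{X,Y}{\otimes}\mathrm{Ind}_{Y'}^Y(N)\;\cong\;\bigoplus_{(x,y)}\mathrm{Ind}_{{}^xX'*{}^yY'}^{X*Y}\Bigl({}^xM\overset{{}^xX',{}^yY'}{\otimes}{}^yN\Bigr),$$ where $(x,y)$ runs through a set of representatives of the $(X\times_HY,\,X'\times Y')$-double cosets of $X\times Y$. The isomorphism is induced by the maps $m\otimes n\mapsto(x\otimes m)\otimes(y\otimes n)$ from ${}^xM\overset{{}^xX',{}^yY'}{\otimes}{}^yN$ to $\mathrm{Ind}_{X'}^X(M)\overset{X,Y}{\otimes}\mathrm{Ind}_{Y'}^Y(N)$. It is natural in $M$ and $N$, providing a natural isomorphism of functors from the product of the categories of left $\Bbbk X'$-modules and left $\Bbbk Y'$-modules to the category of left $\Bbbk[X*Y]$-modules.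
   Context: **Subgroups of direct products.** For $X\le G\times H$ with projections $p_1\colon G\times H\to G$, $p_2\colon G\times H\to H$, set $k_1(X)=\{g\in G\mid(g,1)\in X\}$ and $k_2(X)=\{h\in H\mid(1,h)\in X\}$; similarly for $Y\le H\times K$. For $X\le G\times H$ and $Y\le H\times K$ set $$X*Y=\{(g,k)\in G\times K\mid\exists h\in H:(g,h)\in X,\ (h,k)\in Y\}\le G\times K,$$ $k(X,Y)=k_2(X)\cap k_1(Y)\le H$, and $X\times_HY=\{((g,h),(\tilde h,k))\in X\times Y\mid h=\tilde h\}\le X\times Y$. **Extended tensor product.** Let $M$ be a left $\Bbbk X$-module and $N$ a left $\Bbbk Y$-module. By restriction, $M$ is a $(\Bbbk k_1(X),\Bbbk k(X,Y))$-bimodule via $g\cdot m\cdot h=(g,h^{-1})m$, and $N$ is a $(\Bbbk k(X,Y),\Bbbk k_2(Y))$-bimodule via $h\cdot n\cdot k=(h,k^{-1})n$. On $M\otimes_{\Bbbk k(X,Y)}N$ the group $X*Y$ acts by $(g,k)(m\otimes n)=(g,h)m\otimes(h,k)n$, where $h\in H$ is any element with $(g,h)\in X$ and $(h,k)\in Y$ (this is well defined and independent of $h$). The resulting left $\Bbbk[X*Y]$-module is denoted $M\overset{X,Y}{\otimes}N$. **Conjugation and induction.** For $x\in X$, ${}^xX'=xX'x^{-1}$ and ${}^xM$ is the $\Bbbk$-module $M$ endowed with the $\Bbbk[{}^xX']$-module structure obtained via the conjugation map $c_{x^{-1}}\colon{}^xX'\to X'$, $z\mapsto x^{-1}zx$;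 similarly for $Y'$, $y\in Y$, $N$. Induction is $\mathrm{Ind}_{X'}^X(M)=\Bbbk X\otimes_{\Bbbk X'}M$. *)

(* Defs.v *)
From HB Require Import structures.
From mathcomp Require Import all_boot all_fingroup all_algebra.
From mathcomp Require Import boolp.
From mathcomp Require Import generic_quotient freeg.

Set Implicit Arguments.
Unset Strict Implicit.
Unset Printing Implicit Defensive.

Import GRing.Theory.
Local Open Scope ring_scope.

(* The group algebra [k A], with the convolution product (the alias hides the
   pointwise product of {ffun _ -> k}).  Left [k A]-modules are the objects of
   [lmodType (galg k A)]. *)
Definition galg (k : comPzRingType) (gT : finGroupType) (A : {group gT}) : Type :=
  {ffun subg_of A -> k}.

Section GroupAlgebra.
Variables (k : comPzRingType) (gT : finGroupType) (A : {group gT}).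

HB.instance Definition _ := GRing.Zmodule.copy (galg k A) {ffun subg_of A -> k}.

Definition galg_coef (a : galg k A) (x : subg_of A) : k :=
  (a : {ffun subg_of A -> k}) x.

(* The element [c x] of [k A]; by convention it is [0] when [x \notin A]. *)
Definition gmon (c : k) (x : gT) : galg k A :=
  [ffun y : subg_of A => c *+ (val y == x)].

Definition gelt : gT -> galg k A := gmon 1.

Definition galg_one : galg k A := gelt 1%g.

Definition galg_mul (a b : galg k A) : galg k A :=
  [ffun x => \sum_y galg_coef a y * galg_coef b (y^-1 * x)%g].

Lemma galgP (a b : galg k A) : galg_coef a =1 galg_coef b -> a = b.
Proof. by move=> ab; apply/ffunP. Qed.

Lemma coefD (a b : galg k A) x :
  galg_coef (a + b) x = galg_coef a x + galg_coef b x.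
Proof. by rewrite /galg_coef ffunE. Qed.

Lemma coef_sum (I : Type) (r : seq I) (P : pred I) (F : I -> galg k A) x :
  galg_coef (\sum_(i <- r | P i) F i) x = \sum_(i <- r | P i) galg_coef (F i) x.
Proof. by rewrite /galg_coef sum_ffunE. Qed.

Lemma coef_gmon c z x : galg_coef (gmon c z) x = c *+ (val x == z).
Proof. by rewrite /galg_coef ffunE. Qed.

Lemma coef_mul a b x :
  galg_coef (galg_mul a b) x = \sum_y galg_coef a y * galg_coef b (y^-1 * x)%g.
Proof. by rewrite /galg_coef ffunE. Qed.

Fact galg_mulA : associative galg_mul.
Proof.
move=> a b c; apply: galgP => x; rewrite !coef_mul.
under eq_bigr do rewrite coef_mul mulr_sumr.
under [RHS]eq_bigr do rewrite coef_mul mulr_suml.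
rewrite [RHS]exchange_big /=; apply: eq_bigr => y _.
rewrite [RHS](reindex_inj (mulgI y)); apply: eq_bigr => z _ /=.
by rewrite mulrA mulKg invMg mulgA.
Qed.

Fact galg_mul1 : left_id galg_one galg_mul.
Proof.
move=> a; apply: galgP => x; rewrite coef_mul (bigD1 (1%g : subg_of A)) //=.
rewrite coef_gmon eqxx mul1r invg1 mul1g big1 ?addr0 // => y ny.
by rewrite coef_gmon -(inj_eq val_inj) in ny *; rewrite (negPf ny) mul0r.
Qed.

Fact galg_mulr1 : right_id galg_one galg_mul.
Proof.
move=> a; apply: galgP => x; rewrite coef_mul (bigD1 x) //=.
rewrite coef_gmon mulVg eqxx mulr1 big1 ?addr0 // => y ny.
rewrite coef_gmon (_ : _ == _ = false) ?mulr0 //; apply/negP => /eqP e.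
case/eqP: ny; apply/eqP; rewrite eq_sym -[x](mulKVg y).
have -> : (y^-1 * x)%g = 1%g by apply: val_inj.
by rewrite mulg1.
Qed.

Fact galg_mulDl : left_distributive galg_mul +%R.
Proof.
move=> a b c; apply: galgP => x; rewrite coefD !coef_mul -big_split /=.
by apply: eq_bigr => y _; rewrite coefD mulrDl.
Qed.

Fact galg_mulDr : right_distributive galg_mul +%R.
Proof.
move=> a b c; apply: galgP => x; rewrite coefD !coef_mul -big_split /=.
by apply: eq_bigr => y _; rewrite coefD mulrDr.
Qed.

HB.instance Definition _ := GRing.Zmodule_isPzRing.Build (galg k A)
  galg_mulA galg_mul1 galg_mulr1 galg_mulDl galg_mulDr.

Lemma galg1E : 1 = gelt 1 :> galg k A. Proof. by []. Qed.

Lemma gmon0 z : gmon 0 z = 0.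
Proof. by apply: galgP => x; rewrite coef_gmon mul0rn /galg_coef ffunE. Qed.

Lemma gmonD c d z : gmon (c + d) z = gmon c z + gmon d z.
Proof. by apply: galgP => x; rewrite coefD !coef_gmon mulrnDl. Qed.

Lemma gmonM c d y z : y \in A -> z \in A ->
  gmon c y * gmon d z = gmon (c * d) (y * z)%g.
Proof.
move=> Ay Az; apply: galgP => x; rewrite coef_mul (bigD1 (subg A y)) //=.
rewrite !coef_gmon subgK // eqxx big1 ?addr0; last first.
  move=> u nu; rewrite coef_gmon; case: eqP => [e|]; last by rewrite mul0r.
  by case/eqP: nu; apply: val_inj; rewrite /= subgK.
rewrite mulr1n mulrnAr; congr (_ *+ nat_of_bool _).
by rewrite /= subgK // -(inj_eq (mulgI y)) mulKVg.
Qed.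

Lemma galg_sum (a : galg k A) : a = \sum_x gmon (galg_coef a x) (val x).
Proof.
apply: galgP => x; rewrite coef_sum (bigD1 x) //= coef_gmon eqxx big1 ?addr0 //.
by move=> y ny; rewrite coef_gmon (inj_eq val_inj) eq_sym (negPf ny).
Qed.

Definition galg_inv (a : (galg k A)^c) : galg k A :=
  [ffun x => galg_coef a (x^-1)%g].

Fact galg_inv_zmod : zmod_morphism galg_inv.
Proof. by move=> a b; apply/ffunP => x; rewrite !ffunE /galg_coef !ffunE. Qed.

Fact galg_inv_monoid : monoid_morphism galg_inv.
Proof.
split=> [|a b].
  apply: galgP => x; rewrite [LHS]ffunE !coef_gmon.
  by rewrite -[val x^-1%g]/((val x)^-1)%g invg_eq1.
apply: galgP => x; rewrite coef_mul {1}/galg_coef ffunE coef_mul.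
rewrite (reindex_inj (mulgI (x^-1)%g)) /=; apply: eq_bigr => y _.
by rewrite /galg_coef !ffunE mulrC invMg !invgK mulgK invMg invgK.
Qed.

HB.instance Definition _ :=
  GRing.isZmodMorphism.Build (galg k A)^c (galg k A) galg_inv galg_inv_zmod.
HB.instance Definition _ :=
  GRing.isMonoidMorphism.Build (galg k A)^c (galg k A) galg_inv galg_inv_monoid.

Lemma galg_invE c x : x \in A -> galg_inv (gmon c x) = gmon c x^-1%g.
Proof. move=> Ax; apply: galgP => y; rewrite [LHS]ffunE !coef_gmon.
by rewrite -[val y^-1%g]/((val y)^-1)%g eqg_invLR. Qed.

End GroupAlgebra.

Arguments gelt k {gT} A x.
Arguments galg_inv k {gT} A a.

Section GroupAlgebraMap.
Variables (k : comPzRingType) (gT hT : finGroupType).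
Variables (A : {group gT}) (B : {group hT}) (f : gT -> hT).
Hypothesis fM : {in A &, {morph f : x y / (x * y)%g}}.
Hypothesis fB : {in A, forall x, f x \in B}.

(* The proof arguments make the ring morphism instance below inferable. *)
Definition galg_map of {in A &, {morph f : x y / (x * y)%g}}
    & {in A, forall x, f x \in B} := fun a : galg k A =>
  \sum_(x : subg_of A) gmon B (galg_coef a x) (f (val x)).

Local Notation gm := (galg_map fM fB).

Fact galg_map_zmod : zmod_morphism gm.
Proof.
move=> a b; rewrite /galg_map -sumrB; apply: eq_bigr => x _.
by apply: (addIr (gmon B (galg_coef b x) (f (val x)))); rewrite subrK -gmonD -coefD subrK.
Qed.

Lemma galg_map_mon c x : x \in A -> gm (gmon A c x) = gmon B c (f x).
Proof.
move=> Ax; rewrite /galg_map (bigD1 (subg A x)) //= coef_gmon subgK // eqxx.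
rewrite big1 ?addr0 ?mulr1n ?subgK // => u nu; rewrite coef_gmon.
case: eqP => [e|_]; last exact: gmon0.
by case/eqP: nu; apply: val_inj; rewrite /= subgK.
Qed.

Fact galg_map_monoid : monoid_morphism gm.
Proof.
have gm_sum I r (F : I -> galg k A) : gm (\sum_(i <- r) F i) = \sum_(i <- r) gm (F i).
  have gD a b : gm (a + b) = gm a + gm b.
    have gN c : gm (- c) = - gm c.
      by rewrite -[- c]sub0r galg_map_zmod -{1}(subrr 0) galg_map_zmod subrr sub0r.
    by rewrite -{1}(opprK b) galg_map_zmod gN opprK.
  apply: (big_morph _ gD).
  by rewrite -{1}(subrr 0) galg_map_zmod subrr.
split=> [|a b].
  rewrite galg1E /gelt galg_map_mon //; congr (gmon _ _ _).
  by apply: (mulgI (f 1%g)); rewrite -fM ?mulg1.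
rewrite [a in LHS]galg_sum [b in LHS]galg_sum mulr_suml gm_sum /galg_map.
rewrite mulr_suml; apply: eq_bigr => x _; rewrite !mulr_sumr.
rewrite -/(galg_map fM fB _) gm_sum; apply: eq_bigr => y _.
have Ax : val x \in A := valP x; have Ay : val y \in A := valP y.
by rewrite gmonM // galg_map_mon ?groupM // gmonM ?fB // fM.
Qed.

HB.instance Definition _ :=
  GRing.isZmodMorphism.Build (galg k A) (galg k B) gm galg_map_zmod.
HB.instance Definition _ :=
  GRing.isMonoidMorphism.Build (galg k A) (galg k B) gm galg_map_monoid.

End GroupAlgebraMap.

Arguments galg_map k {gT hT A B f} fM fB a.

Definition restr (A B : pzRingType) (phi : {rmorphism A -> B}) (M : lmodType B) :
  Type := M.

Section Restriction.
Variables (A B : pzRingType) (phi : {rmorphism A -> B}) (M : lmodType B).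

HB.instance Definition _ := GRing.Zmodule.copy (restr phi M) M.

Definition restr_scale (a : A) (m : restr phi M) : restr phi M :=
  phi a *: (m : M).

Fact restr_scaleA a b m :
  restr_scale a (restr_scale b m) = restr_scale (a * b) m.
Proof. by rewrite /restr_scale scalerA rmorphM. Qed.

Fact restr_scale1 : left_id 1 restr_scale.
Proof. by move=> m; rewrite /restr_scale rmorph1 scale1r. Qed.

Fact restr_scaleDr : right_distributive restr_scale +%R.
Proof. by move=> a m n; rewrite /restr_scale scalerDr. Qed.

Fact restr_scaleDl m : {morph restr_scale^~ m : a b / a + b}.
Proof. by move=> a b; rewrite /restr_scale rmorphD scalerDl. Qed.

HB.instance Definition _ := GRing.Zmodule_isLmodule.Build A (restr phi M)
  restr_scaleA restr_scale1 restr_scaleDr restr_scaleDl.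

Lemma restrZ (a : A) (m : restr phi M) : a *: m = (phi a *: (m : M) : M).
Proof. by []. Qed.

End Restriction.

Section RestrictionMap.
Variables (A B : pzRingType) (phi : {rmorphism A -> B}) (M N : lmodType B).
Variable f : {linear M -> N}.

Definition restr_map (m : restr phi M) : restr phi N := f m.

Fact restr_map_linear : linear restr_map.
Proof. by move=> a u v; rewrite /restr_map restrZ linearP. Qed.

HB.instance Definition _ := GRing.isLinear.Build A (restr phi M) (restr phi N)
  _ restr_map restr_map_linear.

End RestrictionMap.

Arguments restr_map {A B} phi {M N} f m.

Section Converse.
Variables (A B : pzRingType) (phi : {rmorphism A -> B}).

Definition conv_map : A^c -> B^c := phi.

Fact conv_map_zmod : zmod_morphism conv_map.
Proof. by move=> a b; exact: (rmorphB phi). Qed.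

Fact conv_map_monoid : monoid_morphism conv_map.
Proof. by split=> [|a b]; [exact: (rmorph1 phi) | exact: (rmorphM phi)]. Qed.

HB.instance Definition _ := GRing.isZmodMorphism.Build A^c B^c conv_map conv_map_zmod.
HB.instance Definition _ := GRing.isMonoidMorphism.Build A^c B^c conv_map conv_map_monoid.

End Converse.

(* Right A-modules are left modules over the converse ring A^c.  [M (x)_A N] is
   the free abelian group on M * N modulo the subgroup [tensor_null] generated by
   the biadditivity and A-balancedness relations. *)
Section TensorProduct.
Variables (A : pzRingType) (M : lmodType A^c) (N : lmodType A).

Local Notation F := {freeg (M * N)%type / int}.

Inductive tensor_null : F -> Prop :=
| TensorNull0 : tensor_null 0
| TensorNullB u v : tensor_null u -> tensor_null v -> tensor_null (u - v)
| TensorNullDl m m' n :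
    tensor_null (<< (m + m', n) >> - (<< (m, n) >> + << (m', n) >>))
| TensorNullDr m n n' :
    tensor_null (<< (m, n + n') >> - (<< (m, n) >> + << (m, n') >>))
| TensorNullA (m : M) (a : A) (n : N) :
    tensor_null (<< ((a : A^c) *: m, n) >> - << (m, a *: n) >>).

Definition tensor_null_pred : {pred F} := fun u => `[< tensor_null u >].

Fact tensor_null_zmod : zmod_closed tensor_null_pred.
Proof.
split=> [|u v /asboolP hu /asboolP hv]; apply/asboolP; first exact: TensorNull0.
exact: TensorNullB.
Qed.

HB.instance Definition _ := GRing.isZmodClosed.Build F tensor_null_pred tensor_null_zmod.

Definition tensor : Type := @Quotient.quot F tensor_null_pred.

HB.instance Definition _ := GRing.Zmodule.copy tensor (@Quotient.quot F tensor_null_pred).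

Definition tens (m : M) (n : N) : tensor :=
  \pi_(@Quotient.quot F tensor_null_pred)%qT << (m, n) >>.

End TensorProduct.

Arguments tens {A} M N m n.

Section TensorTheory.
Variables (A : pzRingType) (M : lmodType A^c) (N : lmodType A).

Local Notation F := {freeg (M * N)%type / int}.
Local Notation Q := (@Quotient.quot F (@tensor_null_pred A M N)).
Local Notation "m ** n" := (tens M N m n) (at level 40).

Lemma tensDl m m' n : (m + m') ** n = m ** n + m' ** n.
Proof.
rewrite /tens -[RHS](raddfD (\pi_Q%qT : {additive _ -> _})).
by apply/eqP; rewrite -Quotient.idealrBE; apply/asboolP; exact: TensorNullDl.
Qed.

Lemma tensDr m n n' : m ** (n + n') = m ** n + m ** n'.
Proof.
rewrite /tens -[RHS](raddfD (\pi_Q%qT : {additive _ -> _})).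
by apply/eqP; rewrite -Quotient.idealrBE; apply/asboolP; exact: TensorNullDr.
Qed.

Lemma tensA (a : A) (m : M) (n : N) : ((a : A^c) *: m) ** n = m ** (a *: n).
Proof.
by apply/eqP; rewrite -Quotient.idealrBE; apply/asboolP; exact: TensorNullA.
Qed.

Lemma tensor_ind (P : tensor M N -> Prop) :
  P 0 -> (forall t u, P t -> P u -> P (t - u)) -> (forall m n, P (m ** n)) ->
  forall t, P t.
Proof.
move=> P0 PB Pt t; rewrite -[t](@reprK _ Q) -(freeg_sumE (repr t)).
rewrite [X in P X](raddf_sum (\pi_Q%qT : {additive _ -> _})).
have PN u : P u -> P (- u) by rewrite -[- u]sub0r; apply: PB.
have PD u v : P u -> P v -> P (u + v).
  by move=> Pu Pv; rewrite -[v]opprK; apply: PB => //; apply: PN.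
apply: big_ind => // [[m n]] _.
move: (coeff _ _) => z.
have -> : << z *g (m, n) >> = << (m, n) >> *~ z :> F.
  by rewrite freeg_mulz intz.
rewrite [X in P X](raddfMz (\pi_Q%qT : {additive _ -> _})).
have Pn j : P ((m ** n) *+ j).
  by elim: j => [|j IH]; rewrite ?mulr0n // mulrS; apply: PD.
by case: z => j; [exact: Pn | apply: PN; exact: Pn].
Qed.

End TensorTheory.

Section TensorLift.
Variables (A : pzRingType) (M : lmodType A^c) (N : lmodType A) (Z : zmodType).
Variable b : M -> N -> Z.

Local Notation F := {freeg (M * N)%type / int}.
Local Notation Q := (@Quotient.quot F (@tensor_null_pred A M N)).

Definition balanced : Prop :=
  [/\ forall m m' n, b (m + m') n = b m n + b m' n,
      forall m n n', b m (n + n') = b m n + b m n'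
    & forall (a : A) m n, b ((a : A^c) *: m) n = b m (a *: n)].

Definition free_lift : F -> zmodule Z := fglift (fun p => b p.1 p.2 : zmodule Z).

Definition tensor_lift (t : tensor M N) : Z := free_lift (repr (t : Q)).

Lemma free_liftB u v : free_lift (u - v) = free_lift u - free_lift v.
Proof. exact: lift_is_additive. Qed.

Lemma free_lift0 : free_lift 0 = 0.
Proof. by rewrite -(subrr (0 : F)) free_liftB subrr. Qed.

Lemma free_liftN u : free_lift (- u) = - free_lift u.
Proof. by rewrite -[- u]sub0r free_liftB free_lift0 sub0r. Qed.

Lemma free_liftD u v : free_lift (u + v) = free_lift u + free_lift v.
Proof. by rewrite -{1}(opprK v) free_liftB free_liftN opprK. Qed.

Lemma free_liftE m n : free_lift << (m, n) >> = b m n.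
Proof. by rewrite /free_lift liftU scale1r. Qed.

Hypothesis bP : balanced.

Lemma free_lift_null u : tensor_null u -> free_lift u = 0.
Proof.
case: bP => bDl bDr bA; elim=> [|v w _ hv _ hw|m m' n|m n n'|m a n].
- exact: free_lift0.
- by rewrite free_liftB hv hw subrr.
- by rewrite free_liftB free_liftD !free_liftE bDl subrr.
- by rewrite free_liftB free_liftD !free_liftE bDr subrr.
- by rewrite free_liftB !free_liftE bA subrr.
Qed.

Lemma tensor_lift_pi u : tensor_lift (\pi_Q%qT u) = free_lift u.
Proof.
apply/eqP; rewrite -subr_eq0 -free_liftB; apply/eqP/free_lift_null/asboolP.
suff : repr (\pi_Q%qT u) - u \in @tensor_null_pred A M N by [].
by rewrite Quotient.idealrBE reprK.
Qed.

Lemma tensor_liftE m n : tensor_lift (tens M N m n) = b m n.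
Proof. by rewrite [LHS]tensor_lift_pi free_liftE. Qed.

Lemma tensor_liftB t u : tensor_lift (t - u) = tensor_lift t - tensor_lift u.
Proof.
rewrite -[t](@reprK _ Q) -[u](@reprK _ Q).
rewrite -[X in tensor_lift X](raddfB (\pi_Q%qT : {additive _ -> _})).
by rewrite !tensor_lift_pi free_liftB.
Qed.

Lemma tensor_lift0 : tensor_lift 0 = 0.
Proof. by rewrite -(subrr (0 : tensor M N)) tensor_liftB subrr. Qed.

Lemma tensor_liftD t u : tensor_lift (t + u) = tensor_lift t + tensor_lift u.
Proof.
have hN v : tensor_lift (- v) = - tensor_lift v.
  by rewrite -[- v]sub0r tensor_liftB tensor_lift0 sub0r.
by rewrite -{1}(opprK u) tensor_liftB hN opprK.
Qed.

Lemma tensor_lift_sum (I : Type) (r : seq I) (P : pred I) (E : I -> tensor M N) :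
  tensor_lift (\sum_(i <- r | P i) E i) = \sum_(i <- r | P i) tensor_lift (E i).
Proof. exact: (big_morph _ tensor_liftD tensor_lift0). Qed.

End TensorLift.

Lemma tensor_map_eq (A : pzRingType) (M : lmodType A^c) (N : lmodType A)
    (Z : zmodType) (f g : tensor M N -> Z) :
    {morph f : t u / t - u} -> {morph g : t u / t - u} ->
    (forall m n, f (tens M N m n) = g (tens M N m n)) -> f =1 g.
Proof.
move=> fB gB fg; apply: tensor_ind => // [|t u ht hu].
  by rewrite -(subrr (0 : tensor M N)) fB gB !subrr.
by rewrite fB gB ht hu.
Qed.

Lemma sub_scalable_linear (A : pzRingType) (M N : lmodType A) (f : M -> N) :
  {morph f : t u / t - u} -> scalable f -> linear f.
Proof.
move=> fB fZ a u v.
have f0 : f 0 = 0 by rewrite -(subrr (0 : M)) fB subrr.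
have fN w : f (- w) = - f w by rewrite -[- w]sub0r fB f0 sub0r.
by rewrite -{1}(opprK v) fB fZ fN opprK.
Qed.

Section TensorMap.
Variables (A : pzRingType) (M M' : lmodType A^c) (N N' : lmodType A).
Variables (f : {linear M -> M'}) (g : {linear N -> N'}).

Definition tensor_map : tensor M N -> tensor M' N' :=
  tensor_lift (fun m n => tens M' N' (f m) (g n)).

Fact tensor_map_balanced : balanced (fun m n => tens M' N' (f m) (g n)).
Proof.
split=> [m m' n|m n n'|a m n]; first by rewrite raddfD tensDl.
- by rewrite raddfD tensDr.
- by rewrite !linearZ /= tensA.
Qed.

Lemma tensor_mapE m n : tensor_map (tens M N m n) = tens M' N' (f m) (g n).
Proof. exact/tensor_liftE/tensor_map_balanced. Qed.

Lemma tensor_mapB : {morph tensor_map : t u / t - u}.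
Proof. exact/tensor_liftB/tensor_map_balanced. Qed.

End TensorMap.

(* Extension of scalars: [B (x)_A M], with B the regular (B, A)-bimodule. *)
Definition right_regular (A B : pzRingType) (phi : {rmorphism A -> B}) :
  lmodType A^c := @restr A^c B^c (conv_map phi) (B^c)^o.

Definition ext_scal (A B : pzRingType) (phi : {rmorphism A -> B})
  (M : lmodType A) : Type := tensor (right_regular phi) M.

Section ExtensionOfScalars.
Variables (A B : pzRingType) (phi : {rmorphism A -> B}) (M : lmodType A).

HB.instance Definition _ :=
  GRing.Zmodule.copy (ext_scal phi M) (tensor (right_regular phi) M).

Definition etens (b : B) (m : M) : ext_scal phi M := tens (right_regular phi) M b m.

Definition ext_scale (b : B) : ext_scal phi M -> ext_scal phi M :=
  tensor_lift (fun (c : right_regular phi) m => etens (b * (c : B)) m).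

Lemma etensA b a m : etens (b * phi a) m = etens b (a *: m).
Proof. exact: (tensA (M := right_regular phi)). Qed.

Fact ext_scale_balanced b :
  balanced (fun (c : right_regular phi) m => etens (b * (c : B)) m).
Proof.
split=> [m m' n|m n n'|a m n].
- by rewrite [_ * _](mulrDr b (m : B) m') [LHS]tensDl.
- exact: tensDr.
- by rewrite -etensA -mulrA.
Qed.

Lemma ext_scaleE b c m : ext_scale b (etens c m) = etens (b * c) m.
Proof. exact/tensor_liftE/ext_scale_balanced. Qed.

Lemma ext_scaleB b : {morph ext_scale b : t u / t - u}.
Proof. exact/tensor_liftB/ext_scale_balanced. Qed.

Lemma ext_scalD b : {morph ext_scale b : t u / t + u}.
Proof. exact/tensor_liftD/ext_scale_balanced. Qed.

Lemma etensDl b c m : etens (b + c) m = etens b m + etens c m.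
Proof. exact: tensDl. Qed.

Lemma etensDr b m n : etens b (m + n) = etens b m + etens b n.
Proof. exact: tensDr. Qed.

Fact ext_scaleA b c t : ext_scale b (ext_scale c t) = ext_scale (b * c) t.
Proof.
move: t; apply: tensor_map_eq => [t u|t u|d m].
- by rewrite !ext_scaleB.
- by rewrite ext_scaleB.
- by rewrite !ext_scaleE mulrA.
Qed.

Fact ext_scale1 : left_id 1 ext_scale.
Proof.
apply: tensor_map_eq => [t u||d m]; first by rewrite ext_scaleB.
  by [].
by rewrite [LHS]ext_scaleE mul1r.
Qed.

Fact ext_scaleDr : right_distributive ext_scale +%R.
Proof. by move=> b t u; rewrite ext_scalD. Qed.

Fact ext_scaleDl t : {morph ext_scale^~ t : b c / b + c}.
Proof.
move=> b c; move: t; apply: tensor_map_eq => [t u|t u|d m].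
- by rewrite ext_scaleB.
- by rewrite !ext_scaleB opprD addrACA.
- by rewrite !ext_scaleE mulrDl etensDl.
Qed.

HB.instance Definition _ := GRing.Zmodule_isLmodule.Build B (ext_scal phi M)
  ext_scaleA ext_scale1 ext_scaleDr ext_scaleDl.

Lemma etensZ (b c : B) m : b *: etens c m = etens (b * c) m.
Proof. exact: ext_scaleE. Qed.

End ExtensionOfScalars.

Arguments etens {A B} phi {M} b m.

Section ExtensionMap.
Variables (A B : pzRingType) (phi : {rmorphism A -> B}) (M N : lmodType A).
Variable f : {linear M -> N}.

Definition ext_map : ext_scal phi M -> ext_scal phi N :=
  tensor_map (idfun : {linear right_regular phi -> right_regular phi}) f.

Lemma ext_mapE b m : ext_map (etens phi b m) = etens phi b (f m).
Proof. exact: tensor_mapE. Qed.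

Lemma ext_mapB : {morph ext_map : t u / t - u}.
Proof. exact: tensor_mapB. Qed.

Fact ext_map_linear : linear ext_map.
Proof.
have mapZ b t : ext_map (b *: t) = b *: ext_map t.
  move: t; apply: tensor_map_eq => [t u|t u|c m].
  - by rewrite scalerBr ext_mapB.
  - by rewrite ext_mapB scalerBr.
  - by rewrite [_ *: _]etensZ ext_mapE [in RHS]ext_mapE etensZ.
exact: sub_scalable_linear ext_mapB mapZ.
Qed.

HB.instance Definition _ := GRing.isLinear.Build B (ext_scal phi M) (ext_scal phi N)
  _ ext_map ext_map_linear.

End ExtensionMap.

Arguments ext_map {A B} phi {M N} f t.

Definition k1 (gT hT : finGroupType) (X : {set gT * hT}) : {set gT} :=
  [set g | (g, 1%g) \in X].

Definition k2 (gT hT : finGroupType) (X : {set gT * hT}) : {set hT} :=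
  [set h | (1%g, h) \in X].

Section ProductSubgroups.
Variables (gT hT kT : finGroupType).
Variables (X : {group gT * hT}) (Y : {group hT * kT}).
Local Open Scope group_scope.

Definition kcap : {set hT} := k2 X :&: k1 Y.

Definition star : {set gT * kT} :=
  [set u | [exists h, ((u.1, h) \in X) && ((h, u.2) \in Y)]].

Definition fiberprod : {set (gT * hT) * (hT * kT)} :=
  [set u in setX X Y | u.1.2 == u.2.1].

Lemma kcapP h : reflect ((1, h) \in X /\ (h, 1) \in Y) (h \in kcap).
Proof. by rewrite !inE; apply: andP. Qed.

Lemma starP g z :
  reflect (exists2 h, (g, h) \in X & (h, z) \in Y) ((g, z) \in star).
Proof.
by rewrite inE; apply: (iffP existsP) => [[h /andP[]]|[h Xh Yh]]; exists h => //;
   apply/andP.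
Qed.

Fact kcap_group_set : group_set kcap.
Proof.
apply/group_setP; split=> [|h h' /kcapP[Xh Yh] /kcapP[Xh' Yh']].
  by apply/kcapP; rewrite !group1.
apply/kcapP; move: (groupM Xh Xh') (groupM Yh Yh').
by rewrite -![(_, _) * _]/(_ * _, _ * _) !mulg1.
Qed.
Canonical kcap_group := Group kcap_group_set.

Fact star_group_set : group_set star.
Proof.
apply/group_setP; split=> [|[g z] [g' z'] /starP[h Xh Yh] /starP[h' Xh' Yh']].
  by apply/starP; exists 1; rewrite group1.
by apply/starP; exists (h * h'); [exact: (groupM Xh Xh') | exact: (groupM Yh Yh')].
Qed.
Canonical star_group := Group star_group_set.

End ProductSubgroups.

Section ExtendedTensor.
Variables (k : comPzRingType) (gT hT kT : finGroupType).
Variables (X : {group gT * hT}) (Y : {group hT * kT}).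
Variables (M : lmodType (galg k X)) (N : lmodType (galg k Y)).

Local Notation C := (kcap_group X Y).
Local Notation S := (star_group X Y).
Local Notation inX := (fun h : hT => (1%g : gT, h)).
Local Notation inY := (fun h : hT => (h, 1%g : kT)).

Fact inX_morph : {in C &, {morph inX : h h' / (h * h')%g}}.
Proof. by move=> h h' _ _; rewrite -[RHS]/(_ * _, _ * _)%g mulg1. Qed.

Fact inX_in : {in C, forall h, inX h \in X}.
Proof. by move=> h /kcapP[]. Qed.

Fact inY_morph : {in C &, {morph inY : h h' / (h * h')%g}}.
Proof. by move=> h h' _ _; rewrite -[RHS]/(_ * _, _ * _)%g mulg1. Qed.

Fact inY_in : {in C, forall h, inY h \in Y}.
Proof. by move=> h /kcapP[]. Qed.

(* [m . h = (1, h^-1) m] and [h . n = (h, 1) n] for [h] in [k(X, Y)]. *)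
Definition right_kcap : lmodType (galg k C)^c :=
  @restr (galg k C)^c (galg k C) (galg_inv k C)
    (@restr (galg k C) (galg k X) (galg_map k inX_morph inX_in) M).

Definition left_kcap : lmodType (galg k C) :=
  @restr (galg k C) (galg k Y) (galg_map k inY_morph inY_in) N.

Definition xtensor : Type := tensor right_kcap left_kcap.

HB.instance Definition _ := GRing.Zmodule.copy xtensor (tensor right_kcap left_kcap).

Definition xtens (m : M) (n : N) : xtensor := tens right_kcap left_kcap m n.

(* The choice of the middle element is immaterial: see xactE below. *)
Definition star_mid (u : gT * kT) : hT :=
  odflt 1%g [pick h | ((u.1, h) \in X) && ((h, u.2) \in Y)].

(* The action of [c u], for [c] a scalar and [u] in [X * Y]:
   [c (g, z) (m (x) n) = c (g, h) m (x) (h, z) n]. *)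
Definition xact (c : k) (u : gT * kT) : xtensor -> xtensor :=
  tensor_lift (fun (m : right_kcap) (n : left_kcap) =>
    xtens (gmon X c (u.1, star_mid u) *: (m : M))
          (gelt k Y (star_mid u, u.2) *: (n : N))).

Definition xscale (a : galg k S) (t : xtensor) : xtensor :=
  \sum_(u : subg_of S) xact (galg_coef a u) (val u) t.

Lemma star_midP u : u \in S ->
  (u.1, star_mid u) \in X /\ (star_mid u, u.2) \in Y.
Proof.
case: u => g z /starP[h Xh Yh]; rewrite /star_mid; case: pickP => [h' /andP[]//|].
by move/(_ h); rewrite /= Xh Yh.
Qed.

Lemma xtensDl m m' n : xtens (m + m') n = xtens m n + xtens m' n.
Proof. exact: tensDl. Qed.

Lemma xtensDr m n n' : xtens m (n + n') = xtens m n + xtens m n'.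
Proof. exact: tensDr. Qed.

Lemma xtens_sum_l (I : finType) (F : I -> M) n :
  xtens (\sum_i F i) n = \sum_i xtens (F i) n.
Proof.
apply: (big_morph (xtens^~ n)) => [m m'|]; first exact: xtensDl.
by apply: (addrI (xtens 0 n)); rewrite -xtensDl !addr0.
Qed.

Lemma xtens_sum_r (I : finType) m (F : I -> N) :
  xtens m (\sum_i F i) = \sum_i xtens m (F i).
Proof.
apply: (big_morph (xtens m)) => [n n'|]; first exact: xtensDr.
by apply: (addrI (xtens m 0)); rewrite -xtensDr !addr0.
Qed.

Lemma right_kcapZ d v (m : M) : v \in C ->
  (gmon C d v : (galg k C)^c) *: (m : right_kcap) = gmon X d (1%g, v^-1%g) *: m :> M.
Proof.
move=> Cv; rewrite -[LHS]/(galg_map k inX_morph inX_in (galg_inv k C (gmon C d v)) *: m).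
by rewrite galg_invE // galg_map_mon ?groupV.
Qed.

Lemma left_kcapZ d v (n : N) : v \in C ->
  gmon C d v *: (n : left_kcap) = gmon Y d (v, 1%g) *: n :> N.
Proof.
move=> Cv; rewrite -[LHS]/(galg_map k inY_morph inY_in (gmon C d v) *: n).
by rewrite galg_map_mon.
Qed.

Lemma xtensA d v m n : v \in C ->
  xtens (gmon X d (1%g, v^-1%g) *: m) n = xtens m (gmon Y d (v, 1%g) *: n).
Proof.
move=> Cv; have := @tensA (galg k C) right_kcap left_kcap (gmon C d v) m n.
rewrite /xtens.
have -> : ((gmon C d v : (galg k C)^c) *: (m : right_kcap)) =
          gmon X d (1%g, v^-1%g) *: m :> M.
  exact: right_kcapZ.
have -> : (gmon C d v *: (n : left_kcap)) = gmon Y d (v, 1%g) *: n :> N.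
  exact: left_kcapZ.
by [].
Qed.

Lemma xact_balanced c u : u \in S ->
  balanced (fun (m : right_kcap) (n : left_kcap) =>
    xtens (gmon X c (u.1, star_mid u) *: (m : M))
          (gelt k Y (star_mid u, u.2) *: (n : N))).
Proof.
move=> /star_midP[]; case: u => g z /=; move: (star_mid _) => h Xh Yh.
split=> [m m' n|m n n'|b m n].
- by rewrite [_ *: (_ + _)](scalerDr _ (m : M)) xtensDl.
- by rewrite [_ *: (_ + _)](scalerDr _ (n : N)) xtensDr.
rewrite [b]galg_sum; move: (galg_coef b) => d.
have -> : ((\sum_x gmon C (d x) (val x) : (galg k C)^c) *: m) =
  \sum_x gmon X (d x) (1%g, (val x)^-1%g) *: (m : M) :> M.
  rewrite scaler_suml; apply: eq_bigr => x _.
  exact: right_kcapZ (valP x).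
have -> : ((\sum_x gmon C (d x) (val x)) *: n) =
  \sum_x gmon Y (d x) (val x, 1%g) *: (n : N) :> N.
  rewrite scaler_suml; apply: eq_bigr => x _.
  exact: left_kcapZ (valP x).
rewrite !scaler_sumr xtens_sum_l xtens_sum_r; apply: eq_bigr => x _.
case: x => x /= Cx; move: (d _) => {}d.
have [Xx Yx] := kcapP _ _ _ Cx.
have Xx' : (1%g, x^-1%g) \in X.
  by have := groupVr Xx; rewrite -[(_, _)^-1%g]/(_^-1, _^-1)%g invg1.
pose v := (h * x * h^-1)%g.
have Cv : v \in C.
  apply/kcapP; split.
    have := groupM (groupM Xh Xx) (groupVr Xh).
    by rewrite -[X in X \in _]/(g * 1 * g^-1, v)%g mulg1 mulgV.
  have := groupM (groupM Yh Yx) (groupVr Yh).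
  by rewrite -[X in X \in _]/(v, z * 1 * z^-1)%g mulg1 mulgV.
have [Xv Yv] := kcapP _ _ _ Cv.
have Xv' : (1%g, v^-1%g) \in X.
  by have := groupVr Xv; rewrite -[(_, _)^-1%g]/(_^-1, _^-1)%g invg1.
transitivity (xtens (gmon X d (1%g, v^-1%g) *: (gmon X c (g, h) *: m))
                    (gelt k Y (h, z) *: n)).
  rewrite !scalerA !gmonM //; congr (xtens (gmon X _ _ *: _) _).
    exact: mulrC.
  rewrite -[LHS]/(g * 1, h * x^-1)%g -[RHS]/(1 * g, v^-1 * h)%g mulg1 mul1g.
  by rewrite /v !invMg invgK !mulgA mulgKV.
rewrite xtensA // !scalerA !gmonM // mul1r mulr1; congr (xtens _ (gmon Y _ _ *: _)).
rewrite -[LHS]/(v * h, 1 * z)%g -[RHS]/(h * x, z * 1)%g mulg1 mul1g.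
by rewrite /v mulgKV.
Qed.

Lemma xactE c g h z m n : (g, h) \in X -> (h, z) \in Y ->
  xact c (g, z) (xtens m n) =
  xtens (gmon X c (g, h) *: m) (gelt k Y (h, z) *: n).
Proof.
move=> Xh Yh; have Su : (g, z) \in S by apply/starP; exists h.
rewrite [LHS](tensor_liftE (xact_balanced c Su)).
have [/= ] := star_midP Su; move: (star_mid _) => h' Xh' Yh'.
pose v := (h * h'^-1)%g.
have Cv : v \in C.
  apply/kcapP; split.
    by have := groupM Xh (groupVr Xh'); rewrite -[X in X \in _]/(g * g^-1, v)%g mulgV.
  by have := groupM Yh (groupVr Yh'); rewrite -[X in X \in _]/(v, z * z^-1)%g mulgV.
have [Xv Yv] := kcapP _ _ _ Cv; have [Xv' Yv'] := kcapP _ _ _ (groupVr Cv).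
have -> : gmon X c (g, h) = gmon X 1 (1%g, v^-1^-1%g) * gmon X c (g, h').
  rewrite gmonM ?invgK // mul1r -[(_ * _)%g]/(1 * g, v * h')%g mul1g.
  by rewrite /v mulgKV.
rewrite -scalerA xtensA ?groupV // scalerA gmonM // mul1r.
rewrite -[(_ * _)%g]/(v^-1 * h, 1 * z)%g mul1g.
by rewrite /v invMg invgK mulgKV.
Qed.

Lemma xactB c u : u \in S -> {morph xact c u : t s / t - s}.
Proof. by move=> Su; apply/tensor_liftB/xact_balanced. Qed.

Lemma xactD c u : u \in S -> {morph xact c u : t s / t + s}.
Proof. by move=> Su; apply/tensor_liftD/xact_balanced. Qed.

Lemma xact0 c u : u \in S -> xact c u 0 = 0.
Proof. by move=> Su; apply/tensor_lift0/xact_balanced. Qed.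

Lemma xactDl c d u t : u \in S -> xact (c + d) u t = xact c u t + xact d u t.
Proof.
move=> Su; move: t; apply: tensor_map_eq => [t s|t s|m n].
- exact: xactB.
- by rewrite !xactB // opprD addrACA.
case: u Su => g z /starP[h Xh Yh].
by rewrite !(xactE _ _ _ Xh Yh) gmonD scalerDl xtensDl.
Qed.

Lemma xact0l u t : u \in S -> xact 0 u t = 0.
Proof. by move=> Su; apply: (addrI (xact 0 u t)); rewrite -xactDl // !addr0. Qed.

Lemma xactM c d u v t : u \in S -> v \in S ->
  xact c u (xact d v t) = xact (c * d) (u * v)%g t.
Proof.
move=> Su Sv; move: t; apply: tensor_map_eq => [t s|t s|m n].
- by rewrite !xactB.
- by rewrite xactB ?groupM.
case: u v Su Sv => g z [g' z'] /starP[h Xh Yh] /starP[h' Xh' Yh'].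
rewrite (xactE _ _ _ Xh' Yh') (xactE _ _ _ Xh Yh).
rewrite [RHS](xactE _ _ _ (groupM Xh Xh') (groupM Yh Yh')).
by rewrite !scalerA !gmonM // mul1r.
Qed.

Lemma xact1 t : xact 1 1%g t = t.
Proof.
move: t; apply: tensor_map_eq => [t s||m n] //; first by rewrite xactB ?group1.
rewrite (@xactE 1 1%g 1%g 1%g m n); last 2 first.
- exact: (group1 X).
- exact: (group1 Y).
by rewrite -[gmon X _ _]/(1 : galg k X) -[gelt k Y _]/(1 : galg k Y) !scale1r.
Qed.

Fact xscaleA a b t : xscale a (xscale b t) = xscale (a * b) t.
Proof.
rewrite /xscale.
under eq_bigr => u _.
  rewrite (big_morph (xact _ _) (xactD _ (valP u)) (xact0 _ (valP u))).
  under eq_bigr => v _ do rewrite xactM ?(valP u) ?(valP v) //.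
  over.
under [RHS]eq_bigr => u _.
  rewrite [galg_coef _ _]coef_mul.
  rewrite (big_morph (fun c => xact c (val u) t)
             (fun c d => xactDl c d t (valP u)) (xact0l t (valP u))).
  over.
rewrite [RHS]exchange_big /=; apply: eq_bigr => u _.
rewrite [RHS](reindex_inj (mulgI u)) /=; apply: eq_bigr => v _.
by rewrite mulKg.
Qed.

Fact xscale1 : left_id 1 xscale.
Proof.
move=> t; rewrite /xscale (bigD1 (1%g : subg_of S)) //= coef_gmon eqxx xact1.
rewrite big1 ?addr0 // => u nu; rewrite coef_gmon.
case: eqP => [e|_]; last by rewrite mulr0n xact0l ?(valP u).
by case/eqP: nu; apply: val_inj.
Qed.

Fact xscaleDr : right_distributive xscale +%R.
Proof.
move=> a t s; rewrite /xscale -big_split /=; apply: eq_bigr => u _.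
by rewrite xactD ?(valP u).
Qed.

Fact xscaleDl t : {morph xscale^~ t : a b / a + b}.
Proof.
move=> a b; rewrite /xscale -big_split /=; apply: eq_bigr => u _.
by rewrite coefD xactDl ?(valP u).
Qed.

HB.instance Definition _ := GRing.Zmodule_isLmodule.Build (galg k S) xtensor
  xscaleA xscale1 xscaleDr xscaleDl.

Lemma xtensorZ_act c u t : u \in S -> gmon S c u *: t = xact c u t.
Proof.
move=> Su; rewrite -[LHS]/(xscale (gmon S c u) t) /xscale (bigD1 (subg S u)) //= coef_gmon subgK // eqxx.
rewrite big1 ?addr0 ?mulr1n ?subgK // => v nv; rewrite coef_gmon.
case: eqP => [e|_]; last by rewrite mulr0n xact0l ?(valP v).
by case/eqP: nv; apply: val_inj; rewrite /= subgK.
Qed.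

Lemma xtensorZ g h z m n : (g, h) \in X -> (h, z) \in Y ->
  gelt k S (g, z) *: xtens m n = xtens (gelt k X (g, h) *: m) (gelt k Y (h, z) *: n).
Proof.
move=> Xh Yh; rewrite xtensorZ_act; last by apply/starP; exists h.
exact: xactE.
Qed.

End ExtendedTensor.

Arguments xtens {k gT hT kT X Y M N} m n.

Section ExtendedTensorMap.
Variables (k : comPzRingType) (gT hT kT : finGroupType).
Variables (X : {group gT * hT}) (Y : {group hT * kT}).
Variables (M M' : lmodType (galg k X)) (N N' : lmodType (galg k Y)).
Variables (f : {linear M -> M'}) (g : {linear N -> N'}).

Fact right_kcap_map_linear :
  linear (f : right_kcap Y M -> right_kcap Y M').
Proof. by move=> a u v; rewrite [LHS]linearP. Qed.

Fact left_kcap_map_linear :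
  linear (g : left_kcap X N -> left_kcap X N').
Proof. by move=> a u v; rewrite [LHS]linearP. Qed.

Definition right_kcap_map (m : right_kcap Y M) : right_kcap Y M' := f m.
Definition left_kcap_map (n : left_kcap X N) : left_kcap X N' := g n.

HB.instance Definition _ := GRing.isLinear.Build (galg k (kcap_group X Y))^c
  (right_kcap Y M) (right_kcap Y M') _ right_kcap_map right_kcap_map_linear.
HB.instance Definition _ := GRing.isLinear.Build (galg k (kcap_group X Y))
  (left_kcap X N) (left_kcap X N') _ left_kcap_map left_kcap_map_linear.

Definition xtensor_map : xtensor M N -> xtensor M' N' :=
  tensor_map (right_kcap_map : {linear right_kcap Y M -> right_kcap Y M'})
    (left_kcap_map : {linear left_kcap X N -> left_kcap X N'}).

Lemma xtensor_mapE m n : xtensor_map (xtens m n) = xtens (f m) (g n).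
Proof. exact: tensor_mapE. Qed.

Lemma xtensor_mapB : {morph xtensor_map : t u / t - u}.
Proof. exact: tensor_mapB. Qed.

Fact xtensor_map_linear : linear xtensor_map.
Proof.
apply: (sub_scalable_linear xtensor_mapB) => a t.
have map0 : xtensor_map 0 = 0.
  by rewrite -(subrr (0 : xtensor M N)) xtensor_mapB subrr.
have mapN w : xtensor_map (- w) = - xtensor_map w.
  by rewrite -[- w]sub0r xtensor_mapB map0 sub0r.
have mapD : {morph xtensor_map : t u / t + u}.
  by move=> u v; rewrite -{1}(opprK v) xtensor_mapB mapN opprK.
rewrite [a]galg_sum !scaler_suml (big_morph _ mapD map0).
apply: eq_bigr => u _; case: u (galg_coef a u) => u /= Su c.
move: t; apply: tensor_map_eq => [t s|t s|m n].
- by rewrite scalerBr xtensor_mapB.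
- by rewrite xtensor_mapB scalerBr.
rewrite -/(xtens m n) xtensor_mapE !xtensorZ_act //.
case: u Su => p q /starP[h Xh Yh].
by rewrite !(xactE _ _ _ Xh Yh) xtensor_mapE !linearZ.
Qed.

HB.instance Definition _ := GRing.isLinear.Build (galg k (star_group X Y))
  (xtensor M N) (xtensor M' N') _ xtensor_map xtensor_map_linear.

End ExtendedTensorMap.

(* The index set is finite, so the direct sum is the product. *)

Definition dsum (A : pzRingType) (I : finType) (V : I -> lmodType A) : Type :=
  {dffun forall i : I, V i}.

Section DirectSum.
Variables (A : pzRingType) (I : finType) (V : I -> lmodType A).

HB.instance Definition _ := Choice.copy (dsum V) {dffun forall i : I, V i}.

Definition dsum0 : dsum V := [ffun i : I => 0 : V i].
Definition dsum_opp (s : dsum V) : dsum V := [ffun i : I => - s i].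
Definition dsum_add (s t : dsum V) : dsum V := [ffun i : I => s i + t i].
Definition dsum_scale (a : A) (s : dsum V) : dsum V := [ffun i : I => a *: s i].

Fact dsum_addA : associative dsum_add.
Proof. by move=> r s t; apply/ffunP => i; rewrite !ffunE addrA. Qed.
Fact dsum_addC : commutative dsum_add.
Proof. by move=> r s; apply/ffunP => i; rewrite !ffunE addrC. Qed.
Fact dsum_add0 : left_id dsum0 dsum_add.
Proof. by move=> r; apply/ffunP => i; rewrite !ffunE add0r. Qed.
Fact dsum_addN : left_inverse dsum0 dsum_opp dsum_add.
Proof. by move=> r; apply/ffunP => i; rewrite !ffunE addNr. Qed.

HB.instance Definition _ :=
  GRing.isZmodule.Build (dsum V) dsum_addA dsum_addC dsum_add0 dsum_addN.

Fact dsum_scaleA a b s : dsum_scale a (dsum_scale b s) = dsum_scale (a * b) s.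
Proof. by apply/ffunP => i; rewrite !ffunE scalerA. Qed.
Fact dsum_scale1 : left_id 1 dsum_scale.
Proof. by move=> s; apply/ffunP => i; rewrite !ffunE scale1r. Qed.
Fact dsum_scaleDr : right_distributive dsum_scale +%R.
Proof. by move=> a s t; apply/ffunP => i; rewrite !ffunE scalerDr. Qed.
Fact dsum_scaleDl s : {morph dsum_scale^~ s : a b / a + b}.
Proof. by move=> a b; apply/ffunP => i; rewrite !ffunE scalerDl. Qed.

HB.instance Definition _ := GRing.Zmodule_isLmodule.Build A (dsum V)
  dsum_scaleA dsum_scale1 dsum_scaleDr dsum_scaleDl.

Definition dsum_in (i : I) (v : V i) : dsum V :=
  [ffun j : I => dfwith (fun l : I => 0 : V l) v j].

End DirectSum.

Arguments dsum_in {A I V} i v.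

Section DirectSumMap.
Variables (A : pzRingType) (I : finType) (V W : I -> lmodType A).
Variable f : forall i, {linear V i -> W i}.

Definition dsum_map (s : dsum V) : dsum W := [ffun i : I => f i (s i)].

Fact dsum_map_linear : linear dsum_map.
Proof. by move=> a s t; apply/ffunP => i; rewrite !ffunE linearP. Qed.

HB.instance Definition _ :=
  GRing.isLinear.Build A (dsum V) (dsum W) _ dsum_map dsum_map_linear.

End DirectSumMap.

Record category := Category {
  ob :> Type;
  hom : ob -> ob -> Type;
  idm : forall a, hom a a;
  comp : forall a b c, hom b c -> hom a b -> hom a c;
  compm1 : forall a b (f : hom a b), comp f (idm a) = f;
  comp1m : forall a b (f : hom a b), comp (idm b) f = f;
  compmA : forall a b c d (f : hom c d) (g : hom b c) (h : hom a b),
    comp f (comp g h) = comp (comp f g) h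
}.

Arguments hom {_} _ _.
Arguments idm {_} a.
Arguments comp {_ a b c} _ _.

Record functor (C D : category) := Functor {
  fob :> C -> D;
  fmap : forall a b : C, hom a b -> hom (fob a) (fob b);
  fmap1 : forall a : C, fmap (idm a) = idm (fob a);
  fmapM : forall (a b c : C) (f : hom b c) (g : hom a b),
    fmap (comp f g) = comp (fmap f) (fmap g)
}.

Arguments fmap {C D} _ {a b} _.

Record nat_iso (C D : category) (F G : functor C D) := NatIso {
  nt :> forall a : C, hom (F a) (G a);
  nt_inv : forall a : C, hom (G a) (F a);
  nt_natural : forall (a b : C) (f : hom a b),
    comp (nt b) (fmap F f) = comp (fmap G f) (nt a);
  nt_invK : forall a : C, comp (nt a) (nt_inv a) = idm (G a);
  ntK : forall a : C, comp (nt_inv a) (nt a) = idm (F a)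
}.

Section ProductCategory.
Variables C D : category.

Definition prod_hom (a b : C * D) : Type := (hom a.1 b.1 * hom a.2 b.2)%type.
Definition prod_id (a : C * D) : prod_hom a a := (idm a.1, idm a.2).
Definition prod_comp (a b c : C * D) (f : prod_hom b c) (g : prod_hom a b) :
  prod_hom a c := (comp f.1 g.1, comp f.2 g.2).

Fact prod_compm1 a b (f : prod_hom a b) : prod_comp f (prod_id a) = f.
Proof. by case: f => f g; rewrite /prod_comp !compm1. Qed.

Fact prod_comp1m a b (f : prod_hom a b) : prod_comp (prod_id b) f = f.
Proof. by case: f => f g; rewrite /prod_comp !comp1m. Qed.

Fact prod_compmA a b c d (f : prod_hom c d) (g : prod_hom b c) (h : prod_hom a b) :
  prod_comp f (prod_comp g h) = prod_comp (prod_comp f g) h.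
Proof. by rewrite /prod_comp !compmA. Qed.

Definition prod_cat : category := Category prod_compm1 prod_comp1m prod_compmA.

End ProductCategory.

Section ProductFunctor.
Variables (C D C' D' : category) (F : functor C C') (G : functor D D').

Definition prod_fob (a : prod_cat C D) : prod_cat C' D' := (F a.1, G a.2).
Definition prod_fmap (a b : prod_cat C D) (f : hom a b) :
  hom (prod_fob a) (prod_fob b) := (fmap F f.1, fmap G f.2).

Fact prod_fmap1 a : prod_fmap (idm a) = idm (prod_fob a).
Proof. by rewrite /prod_fmap !fmap1. Qed.

Fact prod_fmapM a b c (f : hom b c) (g : hom a b) :
  prod_fmap (comp f g) = comp (prod_fmap f) (prod_fmap g).
Proof. by rewrite /prod_fmap !fmapM. Qed.

Definition prod_functor : functor (prod_cat C D) (prod_cat C' D') :=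
  Functor prod_fmap1 prod_fmapM.

End ProductFunctor.

Section ComposedFunctor.
Variables (C D E : category) (G : functor D E) (F : functor C D).

Definition comp_fmap (a b : C) (f : hom a b) : hom (G (F a)) (G (F b)) :=
  fmap G (fmap F f).

Fact comp_fmap1 a : comp_fmap (idm a) = idm (G (F a)).
Proof. by rewrite /comp_fmap !fmap1. Qed.

Fact comp_fmapM a b c (f : hom b c) (g : hom a b) :
  comp_fmap (comp f g) = comp (comp_fmap f) (comp_fmap g).
Proof. by rewrite /comp_fmap !fmapM. Qed.

Definition comp_functor : functor C E :=
  @Functor C E (fun a => G (F a)) comp_fmap comp_fmap1 comp_fmapM.

End ComposedFunctor.

Lemma linear_eq (A : pzRingType) (M N : lmodType A) (f g : {linear M -> N}) :
  f =1 g -> f = g.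
Proof.
case: f g => f [[fD] [fZ]] [g [[gD] [gZ]]] /= /funext fg; subst g.
by rewrite (Prop_irrelevance fD gD) (Prop_irrelevance fZ gZ).
Qed.

Section ModuleCategory.
Variable A : pzRingType.

Definition lid (M : lmodType A) : {linear M -> M} := idfun.
Definition lcomp (M N P : lmodType A) (f : {linear N -> P}) (g : {linear M -> N}) :
  {linear M -> P} := (f \o g)%FUN.

Fact lcompm1 (M N : lmodType A) (f : {linear M -> N}) : lcomp f (lid M) = f.
Proof. exact: linear_eq. Qed.

Fact lcomp1m (M N : lmodType A) (f : {linear M -> N}) : lcomp (lid N) f = f.
Proof. exact: linear_eq. Qed.

Fact lcompmA (M N P Q : lmodType A) (f : {linear P -> Q}) (g : {linear N -> P})
  (h : {linear M -> N}) : lcomp f (lcomp g h) = lcomp (lcomp f g) h.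
Proof. exact: linear_eq. Qed.

Definition mod_cat : category := Category lcompm1 lcomp1m lcompmA.

End ModuleCategory.

Section ScalarFunctors.
Variables (A B : pzRingType) (phi : {rmorphism A -> B}).

Definition ext_fob (M : mod_cat A) : mod_cat B := ext_scal phi (M : lmodType A).
Definition ext_fmap (M N : mod_cat A) (f : hom M N) : hom (ext_fob M) (ext_fob N) :=
  ext_map phi (f : {linear _ -> _}) : {linear _ -> _}.

Fact ext_fmap1 M : ext_fmap (idm M) = idm (ext_fob M).
Proof.
apply: linear_eq; apply: tensor_map_eq => //; first exact: ext_mapB.
by move=> b m; apply: ext_mapE.
Qed.

Fact ext_fmapM M N P (f : hom N P) (g : hom M N) :
  ext_fmap (comp f g) = comp (ext_fmap f) (ext_fmap g).
Proof.
apply: linear_eq; apply: tensor_map_eq; first exact: ext_mapB.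
  by move=> t u /=; rewrite !ext_mapB.
move=> b m; rewrite [LHS]ext_mapE.
by symmetry; rewrite /= [X in ext_map _ _ X]ext_mapE [LHS]ext_mapE.
Qed.

Definition ext_functor : functor (mod_cat A) (mod_cat B) :=
  Functor ext_fmap1 ext_fmapM.

Definition restr_fob (M : mod_cat B) : mod_cat A := restr phi (M : lmodType B).
Definition restr_fmap (M N : mod_cat B) (f : hom M N) :
  hom (restr_fob M) (restr_fob N) :=
  restr_map phi (f : {linear _ -> _}) : {linear _ -> _}.

Fact restr_fmap1 M : restr_fmap (idm M) = idm (restr_fob M).
Proof. exact: linear_eq. Qed.

Fact restr_fmapM M N P (f : hom N P) (g : hom M N) :
  restr_fmap (comp f g) = comp (restr_fmap f) (restr_fmap g).
Proof. exact: linear_eq. Qed.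

Definition restr_functor : functor (mod_cat B) (mod_cat A) :=
  Functor restr_fmap1 restr_fmapM.

End ScalarFunctors.

Section DirectSumFunctor.
Variables (C : category) (A : pzRingType) (I : finType).
Variable F : I -> functor C (mod_cat A).

Definition dsum_fob (a : C) : mod_cat A := dsum (fun i => F i a : lmodType A).
Definition dsum_fmap (a b : C) (f : hom a b) : hom (dsum_fob a) (dsum_fob b) :=
  dsum_map (fun i => fmap (F i) f : {linear _ -> _}) : {linear _ -> _}.

Fact dsum_fmap1 a : dsum_fmap (idm a) = idm (dsum_fob a).
Proof. by apply: linear_eq => s; apply/ffunP => i; rewrite ffunE fmap1. Qed.

Fact dsum_fmapM a b c (f : hom b c) (g : hom a b) :
  dsum_fmap (comp f g) = comp (dsum_fmap f) (dsum_fmap g).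
Proof. by apply: linear_eq => s; apply/ffunP => i; rewrite !ffunE fmapM. Qed.

Definition dsum_functor : functor C (mod_cat A) := Functor dsum_fmap1 dsum_fmapM.

End DirectSumFunctor.

Section ExtendedTensorFunctor.
Variables (k : comPzRingType) (gT hT kT : finGroupType).
Variables (X : {group gT * hT}) (Y : {group hT * kT}).

Local Notation MX := (mod_cat (galg k X)).
Local Notation MY := (mod_cat (galg k Y)).
Local Notation MS := (mod_cat (galg k (star_group X Y))).

Definition xtensor_fob (a : prod_cat MX MY) : MS :=
  xtensor (a.1 : lmodType (galg k X)) (a.2 : lmodType (galg k Y)).
Definition xtensor_fmap (a b : prod_cat MX MY) (f : hom a b) :
  hom (xtensor_fob a) (xtensor_fob b) :=
  xtensor_map (f.1 : {linear _ -> _}) (f.2 : {linear _ -> _}) : {linear _ -> _}.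

Fact xtensor_fmap1 a : xtensor_fmap (idm a) = idm (xtensor_fob a).
Proof.
apply: linear_eq; apply: tensor_map_eq => //; first exact: xtensor_mapB.
by move=> m n; apply: xtensor_mapE.
Qed.

Fact xtensor_fmapM a b c (f : hom b c) (g : hom a b) :
  xtensor_fmap (comp f g) = comp (xtensor_fmap f) (xtensor_fmap g).
Proof.
apply: linear_eq; apply: tensor_map_eq; first exact: xtensor_mapB.
  by move=> t u /=; rewrite !xtensor_mapB.
move=> m n; rewrite [LHS]xtensor_mapE.
by symmetry; rewrite /= [X in xtensor_map _ _ X]xtensor_mapE [LHS]xtensor_mapE.
Qed.

Definition xtensor_functor : functor (prod_cat MX MY) MS :=
  Functor xtensor_fmap1 xtensor_fmapM.

End ExtendedTensorFunctor.

Section Induction.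
Variables (k : comPzRingType) (gT : finGroupType) (A B : {group gT}).
Hypothesis sAB : A \subset B.

Fact incl_morph : {in A &, {morph (fun z : gT => z) : y z / (y * z)%g}}.
Proof. by []. Qed.

Fact incl_in : {in A, forall z, z \in B}.
Proof. exact/subsetP. Qed.

Definition galg_incl : {rmorphism galg k A -> galg k B} :=
  galg_map k incl_morph incl_in.

Definition Ind (M : lmodType (galg k A)) : lmodType (galg k B) :=
  ext_scal galg_incl M.

Definition ind_tens (M : lmodType (galg k A)) (b : galg k B) (m : M) : Ind M :=
  etens galg_incl b m.

Definition Ind_functor : functor (mod_cat (galg k A)) (mod_cat (galg k B)) :=
  ext_functor galg_incl.

End Induction.

Arguments Ind {k gT A B} sAB M.
Arguments ind_tens {k gT A B} sAB {M} b m.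
Arguments Ind_functor k {gT A B} sAB.

Section Conjugation.
Variables (k : comPzRingType) (gT : finGroupType) (x : gT) (A : {group gT}).

(* MathComp's [A :^ x] is [x^-1 A x] and its [z ^ x] is [x^-1 z x], so that
   [x A x^-1] is [A :^ x^-1]. *)
Definition lconj : {group gT} := (A :^ x^-1)%G.

Fact conj_morph : {in lconj &, {morph (fun z : gT => z ^ x)%g : y z / (y * z)%g}}.
Proof. by move=> y z _ _; exact: conjMg. Qed.

Fact conj_in : {in lconj, forall z, (z ^ x)%g \in A}.
Proof. by move=> z; rewrite mem_conjgV. Qed.

Definition galg_conj : {rmorphism galg k lconj -> galg k A} :=
  galg_map k conj_morph conj_in.

Definition conj_mod (M : lmodType (galg k A)) : lmodType (galg k lconj) :=
  restr galg_conj M.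

Definition conj_functor : functor (mod_cat (galg k A)) (mod_cat (galg k lconj)) :=
  restr_functor galg_conj.

End Conjugation.

Arguments conj_mod {k gT} x {A} M.
Arguments conj_functor k {gT} x A.

Definition double_cosets (gT : finGroupType) (A Z B : {set gT}) : {set {set gT}} :=
  [set (A :* z * B)%g | z in Z].

Section Mackey.
Variables (k : comPzRingType) (gT hT kT : finGroupType).
Variables (X X' : {group gT * hT}) (Y Y' : {group hT * kT}).
Hypotheses (sX : X' \subset X) (sY : Y' \subset Y).
Variable R : {set (gT * hT) * (hT * kT)}.
Hypothesis sR : R \subset setX X Y.

Local Notation xy i := (val (i : {z | z \in R})).

Fact star_lconjS (i : {z | z \in R}) :
  star_group (lconj (xy i).1 X') (lconj (xy i).2 Y') \subset star_group X Y.
Proof.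
case: i => [[x y] /= Ri].
have /setXP[/= Xx Yy] := subsetP sR _ Ri.
apply/subsetP => -[g z] /starP[h]; rewrite !mem_conjgV => Xh Yh.
apply/starP; exists h.
  by rewrite -(memJ_norm _ (subsetP (normG X) _ Xx)) (subsetP sX).
by rewrite -(memJ_norm _ (subsetP (normG Y) _ Yy)) (subsetP sY).
Qed.

Local Notation MX' := (mod_cat (galg k X')).
Local Notation MY' := (mod_cat (galg k Y')).
Local Notation MS := (mod_cat (galg k (star_group X Y))).

Definition mackey_lhs : functor (prod_cat MX' MY') MS :=
  comp_functor (xtensor_functor k X Y)
    (prod_functor (Ind_functor k sX) (Ind_functor k sY)).

Definition mackey_summand (i : {z | z \in R}) : functor (prod_cat MX' MY') MS :=
  comp_functor (Ind_functor k (star_lconjS i))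
    (comp_functor (xtensor_functor k (lconj (xy i).1 X') (lconj (xy i).2 Y'))
      (prod_functor (conj_functor k (xy i).1 X') (conj_functor k (xy i).2 Y'))).

Definition mackey_rhs : functor (prod_cat MX' MY') MS := dsum_functor mackey_summand.

(* The composite of [t |-> 1 (x) t] and of the injection of the [i]-th summand. *)
Definition mackey_in (M : lmodType (galg k X')) (N : lmodType (galg k Y'))
    (i : {z | z \in R})
    (t : xtensor (conj_mod (xy i).1 M) (conj_mod (xy i).2 N)) :
    (mackey_rhs ((M, N) : prod_cat MX' MY') : lmodType (galg k (star_group X Y))) :=
  dsum_in (V := fun j => mackey_summand j ((M, N) : prod_cat MX' MY')) i
    (ind_tens (star_lconjS i) 1 t).

End Mackey.

Arguments mackey_in {k gT hT kT X X' Y Y'} sX sY {R} sR {M N} i t.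

(* Main.v *)
Require Import Defs.
From HB Require Import structures.
From mathcomp Require Import all_boot all_fingroup all_algebra.

Set Implicit Arguments.
Unset Strict Implicit.
Unset Printing Implicit Defensive.

Import GRing.Theory.
Local Open Scope ring_scope.

(** The target [Ind M (x) Ind N] is spanned by the products of generators
    [(p (x) m) (x) (q (x) n)] with [p] in [X] and [q] in [Y].  Each such pair lies in the
    double coset of exactly one representative [(x, y)], say
    [(p, q) = ((g, h) x a, (h, z) y b)] with [((g, h), (h, z))] in the fiber product
    and [(a, b)] in [setX X' Y'].  Since [(g, z)] acts on the extended tensor product
    through [(g, h)] and [(h, z)], the generator above is [(g, z)] applied to
    [(x (x) a m) (x) (y (x) b n)].  Hence it is the image of the element
    [(g, z) (x) (a m (x) b n)] of the summand of index [(x, y)].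

    The map from the direct sum ([mackey_map]) is obtained from the universal
    properties of induction ([ind_extend]), of the extended tensor product
    ([xtensor_lift]) and of the direct sum ([dsum_extend]).  Its inverse
    ([mackey_inv]) sends the generator of [(p, q)] to the element
    [(g, z) (x) (a m (x) b n)] of the direct sum ([mackey_kernel]).  What has to be
    checked is that this element does not depend on the chosen decomposition of
    [(p, q)] ([decomposition_val_unique]): two decompositions over the same
    representative differ by an element of the fiber product that is also conjugate
    to an element of [setX X' Y'], and this element can be moved across the tensor
    product defining the induced module.  Independence of the choice makes every
    balancing relation needed to extend the formula to the whole tensor product
    ([ind_xtensor_lift]) a comparison of two decompositions of one pair.  The two
    maps are inverse to each other, and natural, by inspection on generators.

    The argument is carried out for an arbitrary finite family of representatives
    [(rx i, ry i)]; the transversal of the theorem is an instance. *)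

(** * Double cosets *)

Section DoubleCosets.
Variables (gT : finGroupType) (A B : {group gT}) (D R : {set gT}).
Local Open Scope group_scope.

Lemma dcosetP (r z : gT) :
  reflect (exists a b, [/\ a \in A, b \in B & z = a * r * b]) (z \in A :* r * B).
Proof.
apply: (iffP mulsgP) => [[_ b /rcosetP[a Aa ->] Bb ->]|[a [b [Aa Bb ->]]]].
  by exists a, b.
by exists (a * r) b => //; apply/rcosetP; exists a.
Qed.

Lemma dcoset_refl r : r \in A :* r * B.
Proof. by apply/dcosetP; exists 1, 1; rewrite !group1 mul1g mulg1. Qed.

Lemma dcoset_trans z r s : s \in A :* z * B -> r \in A :* z * B -> s \in A :* r * B.
Proof.
move=> /dcosetP[a [b [Aa Bb ->]]] /dcosetP[c [d [Ac Bd ->]]].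
apply/dcosetP; exists (a * c^-1), (d^-1 * b).
by rewrite !groupM ?groupV // !mulgA mulgK mulgKV.
Qed.

Hypothesis trR : is_transversal R (double_cosets A D B) D.

Let tiP : trivIset (double_cosets A D B).
Proof. by case/andP: trR => /and3P[]. Qed.

Lemma transversal_dcoset z : z \in D -> exists2 r, r \in R & z \in A :* r * B.
Proof.
move=> Dz; pose r := transversal_repr z R (A :* z * B).
have PB : A :* z * B \in double_cosets A D B by apply: imset_f.
exists r; first exact: (repr_mem_transversal trR).
exact: (dcoset_trans (dcoset_refl z) (repr_mem_pblock trR z PB)).
Qed.

Lemma transversal_dcoset_inj z r s :
  r \in R -> s \in R -> z \in A :* r * B -> z \in A :* s * B -> r = s.
Proof.
move=> Rr Rs zr zs; have sRD := subsetP (transversal_sub trR).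
apply: (pblock_inj trR) => //.
have Pb t : t \in R -> A :* t * B \in double_cosets A D B.
  by move=> /sRD Dt; apply: imset_f.
rewrite (def_pblock tiP (Pb r Rr) (dcoset_refl r)).
rewrite (def_pblock tiP (Pb s Rs) (dcoset_refl s)).
by rewrite -(def_pblock tiP (Pb r Rr) zr) (def_pblock tiP (Pb s Rs) zs).
Qed.

End DoubleCosets.

Section FiberProduct.
Variables (gT hT kT : finGroupType).
Variables (X : {group gT * hT}) (Y : {group hT * kT}).

Lemma fiberprodP u :
  reflect (exists g h z, [/\ (g, h) \in X, (h, z) \in Y & u = ((g, h), (h, z))])
          (u \in fiberprod X Y).
Proof.
apply: (iffP idP) => [|[g [h [z [Xh Yh ->]]]]]; last by rewrite !inE /= Xh Yh /=.
case: u => [[g h] [h' z]]; rewrite !inE /= => /andP[/andP[Xh Yh] /eqP eh].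
by exists g, h, z; rewrite -eh in Yh *.
Qed.

Fact fiberprod_group_set : group_set (fiberprod X Y).
Proof.
apply/group_setP; split=> [|u v].
  by apply/fiberprodP; exists 1%g, 1%g, 1%g; rewrite !group1.
move=> /fiberprodP[g [h [z [Xh Yh ->]]]] /fiberprodP[g' [h' [z' [Xh' Yh' ->]]]].
apply/fiberprodP; exists (g * g')%g, (h * h')%g, (z * z')%g.
by split=> //; [exact: (groupM Xh Xh') | exact: (groupM Yh Yh')].
Qed.
Canonical fiberprod_group := Group fiberprod_group_set.

End FiberProduct.

(** * Additive and linear maps *)

Definition linear_of (A : pzRingType) (M N : lmodType A) (f : M -> N)
    (fL : linear f) : {linear M -> N} :=
  HB.pack f (GRing.isLinear.Build A M N _ f fL).

Section SubtractiveMap.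
Variables (U V : zmodType) (f : U -> V).
Hypothesis fB : {morph f : t u / t - u}.

Lemma morphB0 : f 0 = 0.
Proof. by rewrite -(subrr 0) fB subrr. Qed.

Lemma morphBD : {morph f : t u / t + u}.
Proof. by move=> t u; rewrite -{1}(opprK u) fB -[- u]sub0r fB morphB0 sub0r opprK. Qed.

Lemma morphB_sum (I : Type) (r : seq I) (P : pred I) (E : I -> U) :
  f (\sum_(i <- r | P i) E i) = \sum_(i <- r | P i) f (E i).
Proof. exact: (big_morph f morphBD morphB0). Qed.

End SubtractiveMap.

Section GroupAlgebraModules.
Variables (k : comPzRingType) (gT : finGroupType) (A : {group gT}).

Lemma gmon_gelt c x : x \in A -> gmon A c x = gelt k A x * gmon A c 1%g.
Proof. by move=> Ax; rewrite gmonM // mul1r mulg1. Qed.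

Lemma gmon_geltr c x : x \in A -> gmon A c x = gmon A c 1%g * gelt k A x.
Proof. by move=> Ax; rewrite gmonM // mulr1 mul1g. Qed.

Lemma gelt_scalarC (M : lmodType (galg k A)) c a (m : M) : a \in A ->
  gelt k A a *: (gmon A c 1%g *: m) = gmon A c 1%g *: (gelt k A a *: m).
Proof. by move=> Aa; rewrite !scalerA -gmon_gelt // -gmon_geltr. Qed.

(** An additive map is linear over [k A] as soon as it commutes with the elements
    [c x], which span the group algebra. *)
Lemma galg_linear (M N : lmodType (galg k A)) (f : M -> N) :
  {morph f : t u / t - u} ->
  (forall c x m, x \in A -> f (gmon A c x *: m) = gmon A c x *: f m) ->
  linear f.
Proof.
move=> fB fZ; apply: sub_scalable_linear => // a m.
rewrite [a]galg_sum !scaler_suml (morphB_sum fB).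
by apply: eq_bigr => x _; rewrite fZ ?(valP x).
Qed.

End GroupAlgebraModules.

(** * Maps out of an induced module *)

Section InducedModule.
Variables (k : comPzRingType) (gT : finGroupType) (A B : {group gT}).
Variables (sAB : A \subset B) (M : lmodType (galg k A)).

Lemma ind_tensDl b c (m : M) :
  ind_tens sAB (b + c) m = ind_tens sAB b m + ind_tens sAB c m.
Proof. exact: etensDl. Qed.

Lemma ind_tensDr b (m n : M) :
  ind_tens sAB b (m + n) = ind_tens sAB b m + ind_tens sAB b n.
Proof. exact: etensDr. Qed.

Lemma ind_tensBr b : {morph @ind_tens _ _ _ _ sAB M b : m n / m - n}.
Proof. by move=> m n; rewrite -[in RHS](subrK n m) (ind_tensDr b (m - n)) addrK. Qed.

Lemma ind_tensZ b c (m : M) : b *: ind_tens sAB c m = ind_tens sAB (b * c) m.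
Proof. exact: etensZ. Qed.

Lemma ind_tensA b c x (m : M) : x \in A ->
  ind_tens sAB (b * gmon B c x) m = ind_tens sAB b (gmon A c x *: m).
Proof.
move=> Ax; rewrite /ind_tens -etensA; congr (etens _ (_ * _) _).
by rewrite [RHS]galg_map_mon.
Qed.

(** Scalars of [k] can always be moved to the module, so that an induced module is
    spanned by the elements [p (x) m] with [p] in the group ([ind_map_eq]). *)
Lemma ind_tens_gmon c p (m : M) : p \in B ->
  ind_tens sAB (gmon B c p) m = ind_tens sAB (gelt k B p) (gmon A c 1%g *: m).
Proof. by move=> Bp; rewrite -ind_tensA // -gmon_gelt. Qed.

Lemma ind_map_eq (Z : zmodType) (f g : Ind sAB M -> Z) :
  {morph f : t u / t - u} -> {morph g : t u / t - u} ->
  (forall p m, p \in B ->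
     f (ind_tens sAB (gelt k B p) m) = g (ind_tens sAB (gelt k B p) m)) ->
  f =1 g.
Proof.
move=> fB gB fg; apply: tensor_map_eq => // b m.
rewrite -[tens _ _ _ _]/(ind_tens sAB b m) [b]galg_sum.
have -> : ind_tens sAB (\sum_x gmon B (galg_coef b x) (val x)) m =
          \sum_x ind_tens sAB (gmon B (galg_coef b x) (val x)) m.
  apply: (big_morph (fun b : galg k B => ind_tens sAB b m)) => [c d|].
    exact: ind_tensDl.
  by apply: (addrI (ind_tens sAB 0 m)); rewrite -ind_tensDl !addr0.
rewrite (morphB_sum fB) (morphB_sum gB); apply: eq_bigr => x _.
by rewrite ind_tens_gmon ?(valP x) // fg ?(valP x).
Qed.

Section Lift.
Variables (Z : zmodType) (F : gT -> M -> Z).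
Hypothesis FD : forall p, p \in B -> {morph F p : m n / m + n}.
Hypothesis FA : forall p a m, p \in B -> a \in A ->
  F (p * a)%g m = F p (gelt k A a *: m).

(** The additive map [Ind M -> Z] with [p (x) m |-> F p m], for a family [F p] of
    additive maps with [F (p a) m = F p (a m)].  The coefficient of [p] in an
    element of the group algebra is passed to [F] through the action on [M], as [Z]
    is only an abelian group. *)
Definition ind_lift_fun (b : galg k B) (m : M) : Z :=
  \sum_(p : subg_of B) F (val p) (gmon A (galg_coef b p) 1%g *: m).

Definition ind_lift : Ind sAB M -> Z :=
  tensor_lift (ind_lift_fun : right_regular (galg_incl k sAB) -> M -> Z).

Let F0 p : p \in B -> F p 0 = 0.
Proof. by move=> Bp; apply: (addrI (F p 0)); rewrite -FD // !addr0. Qed.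

Let funDl b c m : ind_lift_fun (b + c) m = ind_lift_fun b m + ind_lift_fun c m.
Proof.
rewrite -big_split; apply: eq_bigr => p _ /=.
by rewrite Defs.coefD gmonD scalerDl FD ?(valP p).
Qed.

Let fun_gmon c p m : p \in B -> ind_lift_fun (gmon B c p) m = F p (gmon A c 1%g *: m).
Proof.
move=> Bp; rewrite /ind_lift_fun (bigD1 (subg B p)) //= coef_gmon subgK // eqxx.
rewrite big1 ?addr0 ?subgK // => q nq; rewrite coef_gmon; case: eqP => [e|_].
  by case/eqP: nq; apply: val_inj; rewrite /= subgK.
by rewrite gmon0 scale0r F0 ?(valP q).
Qed.

Fact ind_lift_balanced :
  balanced (ind_lift_fun : right_regular (galg_incl k sAB) -> M -> Z).
Proof.
split=> [b c m|b m n|a b m]; first exact: funDl.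
  rewrite -big_split; apply: eq_bigr => p _ /=.
  by rewrite scalerDr FD ?(valP p).
rewrite -[LHS]/(ind_lift_fun ((b : galg k B) * galg_incl k sAB a) m).
have fun0l n : ind_lift_fun 0 n = 0.
  by apply: (addrI (ind_lift_fun 0 n)); rewrite -funDl !addr0.
have funDr (c : galg k B) : {morph ind_lift_fun c : n n' / n + n'}.
  move=> n n'; rewrite -big_split; apply: eq_bigr => p _ /=.
  by rewrite scalerDr FD ?(valP p).
have fun0r (c : galg k B) : ind_lift_fun c 0 = 0.
  by apply: (addrI (ind_lift_fun c 0)); rewrite -funDr !addr0.
rewrite [a]galg_sum rmorph_sum mulr_sumr scaler_suml.
rewrite (big_morph (fun c => ind_lift_fun c m) (fun c d => funDl c d m) (fun0l m)).
rewrite (big_morph _ (funDr b) (fun0r b)); apply: eq_bigr => x _.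
have Ax := valP x; move: (val x) (galg_coef a x) Ax => /= {}x e Ax.
have Bx := subsetP sAB x Ax.
have -> : galg_incl k sAB (gmon A e x) = gmon B e x by apply: galg_map_mon.
rewrite [b in LHS]galg_sum [b in RHS]galg_sum mulr_suml.
rewrite (big_morph (fun c => ind_lift_fun c m) (fun c d => funDl c d m) (fun0l m)).
rewrite (big_morph (fun c => ind_lift_fun c _) (fun c d => funDl c d _) (fun0l _)).
apply: eq_bigr => p _; have Bp := valP p.
rewrite gmonM // !fun_gmon ?groupM // FA // !scalerA !gmonM //.
by rewrite mul1r mulg1 mul1g.
Qed.

Lemma ind_liftE p m : p \in B -> ind_lift (ind_tens sAB (gelt k B p) m) = F p m.
Proof.
move=> Bp; rewrite [LHS](tensor_liftE ind_lift_balanced) fun_gmon //.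
by rewrite -[gmon A 1 1%g]/(1 : galg k A) scale1r.
Qed.

Lemma ind_liftB : {morph ind_lift : t u / t - u}.
Proof. exact/tensor_liftB/ind_lift_balanced. Qed.

End Lift.

End InducedModule.

(** * Maps out of an extended tensor product *)

Section ExtendedTensorLift.
Variables (k : comPzRingType) (gT hT kT : finGroupType).
Variables (X : {group gT * hT}) (Y : {group hT * kT}).
Variables (M : lmodType (galg k X)) (N : lmodType (galg k Y)).

Lemma xtens_scalar c (m : M) (n : N) :
  xtens (gmon X c 1%g *: m) n = xtens m (gmon Y c 1%g *: n).
Proof. by rewrite -(xtensA c m n (group1 _)) invg1. Qed.

Lemma xtensor_map_eq (Z : zmodType) (f g : xtensor M N -> Z) :
  {morph f : t u / t - u} -> {morph g : t u / t - u} ->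
  (forall m n, f (xtens m n) = g (xtens m n)) -> f =1 g.
Proof. exact: tensor_map_eq. Qed.

Lemma xtensBl (m m' : M) (n : N) : xtens (m - m') n = xtens m n - xtens m' n.
Proof. by rewrite -[in RHS](subrK m' m) (xtensDl (m - m') m') addrK. Qed.

Lemma xtensBr (m : M) (n n' : N) : xtens m (n - n') = xtens m n - xtens m n'.
Proof. by rewrite -[in RHS](subrK n' n) (xtensDr m (n - n') n') addrK. Qed.

Variables (Z : zmodType) (b : M -> N -> Z).
Hypothesis bDl : forall n, {morph b^~ n : m m' / m + m'}.
Hypothesis bDr : forall m, {morph b m : n n' / n + n'}.
Hypothesis bA : forall d v m n, v \in kcap X Y ->
  b (gmon X d (1%g, v^-1%g) *: m) n = b m (gmon Y d (v, 1%g) *: n).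

(** The additive map on the extended tensor product induced by a biadditive map
    that is balanced over [k(X, Y)]. *)
Definition xtensor_lift : xtensor M N -> Z :=
  tensor_lift (b : right_kcap Y M -> left_kcap X N -> Z).

Fact xtensor_lift_balanced : balanced (b : right_kcap Y M -> left_kcap X N -> Z).
Proof.
have b0l n : b 0 n = 0 by apply: (addrI (b 0 n)); rewrite -bDl !addr0.
have b0r m : b m 0 = 0 by apply: (addrI (b m 0)); rewrite -bDr !addr0.
split=> [m m' n|m n n'|a m n]; [exact: bDl | exact: bDr |].
rewrite [a]galg_sum; move: (galg_coef a) => d.
have -> : ((\sum_x gmon _ (d x) (val x) : (galg k (kcap_group X Y))^c) *: m) =
  \sum_x gmon X (d x) (1%g, (val x)^-1%g) *: (m : M) :> M.
  by rewrite scaler_suml; apply: eq_bigr => x _; exact: right_kcapZ (valP x).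
have -> : (\sum_x gmon (kcap_group X Y) (d x) (val x)) *: n =
  \sum_x gmon Y (d x) (val x, 1%g) *: (n : N) :> N.
  by rewrite scaler_suml; apply: eq_bigr => x _; exact: left_kcapZ (valP x).
rewrite (big_morph (b^~ n) (bDl n) (b0l n)) (big_morph (b m) (bDr m) (b0r m)).
by apply: eq_bigr => x _; apply: bA (valP x).
Qed.

Lemma xtensor_liftE m n : xtensor_lift (xtens m n) = b m n.
Proof. exact/tensor_liftE/xtensor_lift_balanced. Qed.

Lemma xtensor_liftB : {morph xtensor_lift : t u / t - u}.
Proof. exact/tensor_liftB/xtensor_lift_balanced. Qed.

End ExtendedTensorLift.


Section InducedUniversal.
Variables (k : comPzRingType) (gT : finGroupType) (A B : {group gT}).
Variables (sAB : A \subset B) (M : lmodType (galg k A)) (N : lmodType (galg k B)).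
Variable f : M -> N.
Hypothesis fB : {morph f : m n / m - n}.
Hypothesis fZ : forall c a m, a \in A -> f (gmon A c a *: m) = gmon B c a *: f m.

(** The extension of a [k A]-equivariant additive map [M -> N] to the induced module,
    [p (x) m |-> p f(m)]. *)
Definition ind_extend : Ind sAB M -> N := ind_lift (fun p m => gelt k B p *: f m).

Let FD p : p \in B -> {morph (fun m => gelt k B p *: f m) : m n / m + n}.
Proof. by move=> _ m n; rewrite (morphBD fB) scalerDr. Qed.

Let FA p a m : p \in B -> a \in A ->
  gelt k B (p * a)%g *: f m = gelt k B p *: f (gelt k A a *: m).
Proof.
move=> Bp Aa; rewrite fZ // scalerA gmonM ?mul1r //.
exact: (subsetP sAB).
Qed.

Lemma ind_extendE p m : p \in B ->
  ind_extend (ind_tens sAB (gelt k B p) m) = gelt k B p *: f m.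
Proof. exact: ind_liftE. Qed.

Lemma ind_extendB : {morph ind_extend : t u / t - u}.
Proof. exact: ind_liftB. Qed.

Fact ind_extend_linear : linear ind_extend.
Proof.
apply: galg_linear => [|c u t Bu]; first exact: ind_extendB.
move: t; apply: ind_map_eq => [t s|t s|p m Bp].
- by rewrite scalerBr ind_extendB.
- by rewrite ind_extendB scalerBr.
rewrite ind_tensZ gmonM // mulr1 ind_tens_gmon ?groupM // !ind_extendE ?groupM //.
by rewrite fZ // !scalerA !gmonM ?groupM // mul1r mulr1 mulg1.
Qed.

End InducedUniversal.

Section ConjugateModule.
Variables (k : comPzRingType) (gT : finGroupType) (A B : {group gT}).
Variables (sAB : A \subset B) (M : lmodType (galg k A)) (x : gT).

Lemma conj_modZ c u (m : M) : u \in lconj x A ->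
  gmon (lconj x A) c u *: (m : conj_mod x M) = gmon A c (u ^ x)%g *: m :> M.
Proof. by move=> xAu; rewrite restrZ [galg_conj _ _ _ _]galg_map_mon. Qed.

Hypothesis Bx : x \in B.

Lemma lconj_sub : lconj x A \subset B.
Proof.
apply/subsetP => u; rewrite mem_conjgV => /(subsetP sAB).
by rewrite (memJ_norm _ (subsetP (normG B) _ Bx)).
Qed.

(** The map [m |-> x (x) m] from the conjugate module to the induced module is
    equivariant for the conjugate subgroup. *)
Lemma ind_tens_conj c u (m : M) : u \in lconj x A ->
  ind_tens sAB (gelt k B x) (gmon (lconj x A) c u *: (m : conj_mod x M)) =
  gmon B c u *: ind_tens sAB (gelt k B x) m.
Proof.
move=> xAu; have Bu := subsetP lconj_sub u xAu.
have Aux : (u ^ x)%g \in A by rewrite -mem_conjgV.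
rewrite [X in ind_tens _ _ X]conj_modZ // -ind_tensA // ind_tensZ !gmonM //.
  by rewrite mul1r mulr1 -conjgC.
exact: (subsetP sAB).
Qed.

End ConjugateModule.

Section ConjugateTensor.
Variables (k : comPzRingType) (gT hT kT : finGroupType).
Variables (X X' : {group gT * hT}) (Y Y' : {group hT * kT}).
Variables (sX : X' \subset X) (sY : Y' \subset Y).
Variables (M : lmodType (galg k X')) (N : lmodType (galg k Y')).
Variables (x : gT * hT) (y : hT * kT).
Hypotheses (Xx : x \in X) (Yy : y \in Y).

Local Notation xM := (conj_mod x M).
Local Notation yN := (conj_mod y N).

(** The maps [m (x) n |-> (x (x) m) (x) (y (x) n)] that induce the isomorphism. *)
Definition conj_tens (m : xM) (n : yN) : xtensor (Ind sX M) (Ind sY N) :=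
  xtens (ind_tens sX (gelt k X x) m) (ind_tens sY (gelt k Y y) n).

Definition conj_xtensor : xtensor xM yN -> xtensor (Ind sX M) (Ind sY N) :=
  xtensor_lift conj_tens.

Let tDl n : {morph conj_tens^~ n : m m' / m + m'}.
Proof. by move=> m m'; rewrite /conj_tens -xtensDl -ind_tensDr. Qed.

Let tDr m : {morph conj_tens m : n n' / n + n'}.
Proof. by move=> n n'; rewrite /conj_tens -xtensDr -ind_tensDr. Qed.

Let tA d v m n : v \in kcap (lconj x X') (lconj y Y') ->
  conj_tens (gmon (lconj x X') d (1%g, v^-1%g) *: m) n =
  conj_tens m (gmon (lconj y Y') d (v, 1%g) *: n).
Proof.
move=> Cv; have [_ Yv] := kcapP _ _ _ Cv; have [Xv _] := kcapP _ _ _ (groupVr Cv).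
rewrite /conj_tens !ind_tens_conj //.
apply: xtensA; apply/kcapP; split; last exact: (subsetP (lconj_sub sY Yy)).
have [Xv' _] := kcapP _ _ _ Cv.
exact: (subsetP (lconj_sub sX Xx)).
Qed.

Lemma conj_xtens_scalar c (m : M) (n : N) :
  xtens (gmon X' c 1%g *: m : xM) (n : yN) = xtens (m : xM) (gmon Y' c 1%g *: n : yN).
Proof.
have := xtens_scalar c (m : xM) (n : yN).
by rewrite !conj_modZ ?group1 // !conj1g.
Qed.

Lemma conj_xtensorE m n : conj_xtensor (xtens m n) = conj_tens m n.
Proof. exact: xtensor_liftE. Qed.

Lemma conj_xtensorB : {morph conj_xtensor : t u / t - u}.
Proof. exact: xtensor_liftB. Qed.

Lemma conj_xtensorZ c u t : u \in star (lconj x X') (lconj y Y') ->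
  conj_xtensor (gmon (star_group (lconj x X') (lconj y Y')) c u *: t) =
  gmon (star_group X Y) c u *: conj_xtensor t.
Proof.
case: u => g z; case/starP=> h Xh Yh.
have Xh1 := subsetP (lconj_sub sX Xx) _ Xh.
have Yh1 := subsetP (lconj_sub sY Yy) _ Yh.
move: t; apply: xtensor_map_eq => [t s|t s|m n].
- by rewrite scalerBr conj_xtensorB.
- by rewrite conj_xtensorB scalerBr.
rewrite xtensorZ_act; last by apply/starP; exists h.
rewrite (xactE _ _ _ Xh Yh) !conj_xtensorE /conj_tens xtensorZ_act; last first.
  by apply/starP; exists h.
by rewrite (xactE _ _ _ Xh1 Yh1) !ind_tens_conj.
Qed.

End ConjugateTensor.

Section InducedTensorLift.
Variables (k : comPzRingType) (gT hT kT : finGroupType).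
Variables (X X' : {group gT * hT}) (Y Y' : {group hT * kT}).
Variables (sX : X' \subset X) (sY : Y' \subset Y).
Variables (M : lmodType (galg k X')) (N : lmodType (galg k Y')).
Variables (Z : zmodType) (F : gT * hT -> hT * kT -> M -> N -> Z).
Hypothesis FDl : forall p q n, p \in X -> q \in Y ->
  {morph (F p q)^~ n : m m' / m + m'}.
Hypothesis FDr : forall p q m, p \in X -> q \in Y ->
  {morph F p q m : n n' / n + n'}.
Hypothesis FAl : forall p q a m n, p \in X -> q \in Y -> a \in X' ->
  F (p * a)%g q m n = F p q (gelt k X' a *: m) n.
Hypothesis FAr : forall p q b m n, p \in X -> q \in Y -> b \in Y' ->
  F p (q * b)%g m n = F p q m (gelt k Y' b *: n).
Hypothesis Fk : forall p q c m n, p \in X -> q \in Y ->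
  F p q (gmon X' c 1%g *: m) n = F p q m (gmon Y' c 1%g *: n).
Hypothesis FC : forall p q v m n, p \in X -> q \in Y -> v \in kcap X Y ->
  F ((1, v^-1) * p)%g q m n = F p ((v, 1) * q)%g m n.

(** The two induced modules are treated one after the other: [lift1] extends in
    the second variable, [lift2] in both. *)
Let lift1 p m : Ind sY N -> Z := ind_lift (fun q n => F p q m n).

Let lift1E p m q n : p \in X -> q \in Y ->
  lift1 p m (ind_tens sY (gelt k Y q) n) = F p q m n.
Proof. by move=> Xp Yq; apply: ind_liftE => // *; [apply: FDr | apply: FAr]. Qed.

Let lift1B p m : p \in X -> {morph lift1 p m : t u / t - u}.
Proof. by move=> Xp; apply: ind_liftB => // *; [apply: FDr | apply: FAr]. Qed.

Let lift1D u p : p \in X -> {morph (lift1 p)^~ u : m m' / m + m'}.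
Proof.
move=> Xp m m'; move: u; apply: ind_map_eq => [t s|t s|q n Yq].
- exact: lift1B.
- by rewrite !lift1B // opprD addrACA.
by rewrite !lift1E // FDl.
Qed.

Let lift1A u p a m : p \in X -> a \in X' ->
  lift1 (p * a)%g m u = lift1 p (gelt k X' a *: m) u.
Proof.
move=> Xp Xa; have Xpa : (p * a)%g \in X by rewrite groupM // (subsetP sX).
move: u; apply: ind_map_eq => [t s|t s|q n Yq]; [exact: lift1B | exact: lift1B |].
by rewrite !lift1E // FAl.
Qed.

Let lift2 (t : Ind sX M) (u : Ind sY N) : Z := ind_lift (fun p m => lift1 p m u) t.

Let lift2E p m u : p \in X -> lift2 (ind_tens sX (gelt k X p) m) u = lift1 p m u.
Proof. exact: ind_liftE (lift1D u) (lift1A u) p m. Qed.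

Let lift2B u : {morph lift2^~ u : t s / t - s}.
Proof. exact: ind_liftB (lift1D u) (lift1A u). Qed.

Let lift2Br t : {morph lift2 t : u s / u - s}.
Proof.
move=> u s; move: t; apply: ind_map_eq => [t t'|t t'|p m Xp].
- exact: lift2B.
- by rewrite !lift2B !opprD addrACA.
by rewrite !lift2E // lift1B.
Qed.

Let lift2A d v t u : v \in kcap X Y ->
  lift2 (gmon X d (1%g, v^-1%g) *: t) u = lift2 t (gmon Y d (v, 1%g) *: u).
Proof.
move=> Cv; have [_ Yv] := kcapP _ _ _ Cv; have [Xv _] := kcapP _ _ _ (groupVr Cv).
move: t; apply: ind_map_eq => [t s|t s|p m Xp].
- by rewrite scalerBr lift2B.
- by rewrite lift2B.
rewrite ind_tensZ gmonM // mulr1 ind_tens_gmon ?groupM // !lift2E ?groupM //.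
move: u; apply: ind_map_eq => [t s|t s|q n Yq].
- by rewrite lift1B ?groupM.
- by rewrite scalerBr lift1B.
rewrite ind_tensZ gmonM // mulr1 ind_tens_gmon ?groupM // !lift1E ?groupM //.
by rewrite FC // Fk ?groupM.
Qed.

(** The additive map with [(p (x) m) (x) (q (x) n) |-> F p q m n], for a family
    [F p q] of biadditive maps compatible with [X'], [Y'], the scalars and
    [k(X, Y)]. *)
Definition ind_xtensor_lift : xtensor (Ind sX M) (Ind sY N) -> Z :=
  xtensor_lift (fun t u => ind_lift (fun p m => ind_lift (F p ^~ m) u) t).

Lemma ind_xtensor_liftE p q m n : p \in X -> q \in Y ->
  ind_xtensor_lift (xtens (ind_tens sX (gelt k X p) m) (ind_tens sY (gelt k Y q) n)) =
  F p q m n.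
Proof.
move=> Xp Yq; rewrite -(lift1E m n Xp Yq) -(lift2E m _ Xp).
apply: (@xtensor_liftE _ _ _ _ _ _ _ _ _ lift2) => [u|t|d v t u].
- exact: morphBD (lift2B u).
- exact: morphBD (lift2Br t).
exact: lift2A.
Qed.

Lemma ind_xtensor_liftB : {morph ind_xtensor_lift : t u / t - u}.
Proof.
apply: (@xtensor_liftB _ _ _ _ _ _ _ _ _ lift2) => [u|t|d v t u].
- exact: morphBD (lift2B u).
- exact: morphBD (lift2Br t).
exact: lift2A.
Qed.

End InducedTensorLift.

(** The products of generators span the tensor product of two induced modules. *)
Lemma ind_xtensor_map_eq (k : comPzRingType) (gT hT kT : finGroupType)
    (X X' : {group gT * hT}) (Y Y' : {group hT * kT})
    (sX : X' \subset X) (sY : Y' \subset Y)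
    (M : lmodType (galg k X')) (N : lmodType (galg k Y')) (Z : zmodType)
    (f g : xtensor (Ind sX M) (Ind sY N) -> Z) :
  {morph f : t u / t - u} -> {morph g : t u / t - u} ->
  (forall p q m n, p \in X -> q \in Y ->
    f (xtens (ind_tens sX (gelt k X p) m) (ind_tens sY (gelt k Y q) n)) =
    g (xtens (ind_tens sX (gelt k X p) m) (ind_tens sY (gelt k Y q) n))) ->
  f =1 g.
Proof.
move=> fB gB fg; apply: xtensor_map_eq => // t u; move: t.
apply: ind_map_eq => [t s|t s|p m Xp]; rewrite ?xtensBl ?fB ?gB //.
move: u; apply: ind_map_eq => [t s|t s|q n Yq]; rewrite ?xtensBr ?fB ?gB //.
exact: fg.
Qed.

(** * Direct sums *)

Section DirectSumTheory.
Variables (A : pzRingType) (I : finType) (V : I -> lmodType A).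

Lemma dsum_inE i (v : V i) : dsum_in i v i = v.
Proof. by rewrite ffunE dfwith_in. Qed.

Lemma dsum_in_neq i j (v : V i) : i != j -> dsum_in i v j = 0.
Proof. by move=> nij; rewrite ffunE dfwith_out. Qed.

Lemma dsum_linearP (a : A) (s t : dsum V) i : (a *: s + t) i = a *: s i + t i.
Proof. by rewrite !ffunE. Qed.

Lemma dsumBE (s t : dsum V) i : (s - t) i = s i - t i.
Proof. by rewrite !ffunE. Qed.

Lemma dsum_sumE (J : finType) (E : J -> dsum V) i : (\sum_j E j) i = \sum_j E j i.
Proof.
by apply: (big_morph (fun s : dsum V => s i)) => [s t|]; rewrite !ffunE.
Qed.

Lemma dsum_inB i : {morph (dsum_in i : V i -> dsum V) : u v / u - v}.
Proof.
move=> u v; apply/ffunP => j; rewrite dsumBE.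
have [<-|nij] := eqVneq i j; first by rewrite !dsum_inE.
by rewrite !dsum_in_neq // subr0.
Qed.

Lemma dsum_decomp (s : dsum V) : s = \sum_i dsum_in i (s i).
Proof.
apply/ffunP => j; rewrite dsum_sumE (bigD1 j) //= dsum_inE big1 ?addr0 // => i nij.
exact: dsum_in_neq.
Qed.

Lemma dsum_map_eq (Z : zmodType) (f g : dsum V -> Z) :
  {morph f : t u / t - u} -> {morph g : t u / t - u} ->
  (forall i v, f (dsum_in (V := V) i v) = g (dsum_in (V := V) i v)) -> f =1 g.
Proof.
move=> fB gB fg s; rewrite [s]dsum_decomp (morphB_sum fB) (morphB_sum gB).
exact: eq_bigr.
Qed.

Variables (W : lmodType A) (f : forall i, V i -> W).
Hypothesis fL : forall i, linear (f (i := i)).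

Definition dsum_extend (s : dsum V) : W := \sum_i f (s i).

Fact dsum_extend_linear : linear dsum_extend.
Proof.
move=> a s t; rewrite /dsum_extend scaler_sumr -big_split /=.
by apply: eq_bigr => i _; rewrite dsum_linearP fL.
Qed.

Lemma dsum_extendE i (v : V i) : dsum_extend (dsum_in i v) = f v.
Proof.
rewrite /dsum_extend (bigD1 i) //= dsum_inE big1 ?addr0 // => j nji.
rewrite dsum_in_neq; last by rewrite eq_sym.
by have := fL (-1) (0 : V j) 0; rewrite scaler0 addr0 scaleN1r addNr.
Qed.

End DirectSumTheory.

Lemma dsum_map_in (A : pzRingType) (I : finType) (V W : I -> lmodType A)
    (f : forall i, {linear V i -> W i}) i (v : V i) :
  dsum_map f (dsum_in i v) = dsum_in i (f i v).
Proof.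
apply/ffunP => j; rewrite ffunE.
have [<-|nij] := eqVneq i j; first by rewrite !dsum_inE.
by rewrite !dsum_in_neq // linear0.
Qed.

(** * Mackey decomposition *)

Section MackeyDecomposition.
Variables (k : comPzRingType) (gT hT kT : finGroupType).
Variables (X X' : {group gT * hT}) (Y Y' : {group hT * kT}).
Variables (sX : X' \subset X) (sY : Y' \subset Y).
Variables (I : finType) (rx : I -> gT * hT) (ry : I -> hT * kT).
Hypotheses (Xr : forall i, rx i \in X) (Yr : forall i, ry i \in Y).
Hypothesis sS : forall i,
  star_group (lconj (rx i) X') (lconj (ry i) Y') \subset star_group X Y.

Local Notation dcoset i :=
  (fiberprod_group X Y :* (rx i, ry i) * setX_group X' Y')%g.

Hypothesis dcoset_cover : forall u, u \in setX X Y -> exists i, u \in dcoset i.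
Hypothesis dcoset_inj : forall u i j, u \in dcoset i -> u \in dcoset j -> i = j.

(** Data [(i, (g, h, z), (a, b))] express [(p, q)] as
    [((g, h), (h, z)) * (x, y) * (a, b)], where [(x, y)] is the [i]-th representative. *)
Definition decomposition : Type :=
  (I * (gT * hT * kT) * ((gT * hT) * (hT * kT)))%type.

HB.instance Definition _ := Finite.on decomposition.

(** [d] is a decomposition of the pair [(p, q)] with respect to the
    representatives, as above. *)
Definition decomposes (p : gT * hT) (q : hT * kT) (d : decomposition) : bool :=
  let: (i, (g, h, z), (a, b)) := d in
  [&& (g, h) \in X, (h, z) \in Y, a \in X', b \in Y',
      p == ((g, h) * rx i * a)%g & q == ((h, z) * ry i * b)%g].

Lemma decomposition_exists p q : p \in X -> q \in Y -> exists d, decomposes p q d.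
Proof.
move=> Xp Yq; have XYpq : (p, q) \in setX X Y by apply/setXP.
have [i] := dcoset_cover XYpq.
case/dcosetP=> u [[a b] [/fiberprodP[g [h [z [Xh Yh ->]]]] /setXP[Xa Yb] [-> ->]]].
exists (i, (g, h, z), (a, b)).
by rewrite /decomposes Xh Yh Xa Yb !eqxx.
Qed.

Lemma decomposition_index p q d d' :
  decomposes p q d -> decomposes p q d' -> d.1.1 = d'.1.1.
Proof.
case: d d' => [[i [[g h] z]] [a b]] [[i' [[g' h'] z']] [a' b']] /=.
move=> /and5P[Xh Yh Xa Yb /andP[/eqP ep /eqP eq]].
move=> /and5P[Xh' Yh' Xa' Yb' /andP[/eqP ep' /eqP eq']].
have mem_dcoset (j : I) g1 h1 z1 c d : (g1, h1) \in X -> (h1, z1) \in Y ->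
    c \in X' -> d \in Y' -> p = ((g1, h1) * rx j * c)%g ->
    q = ((h1, z1) * ry j * d)%g ->
    (p, q) \in (fiberprod_group X Y :* (rx j, ry j) * setX_group X' Y')%g.
  move=> X1 Y1 Xc Yd -> ->; apply/dcosetP; exists ((g1, h1), (h1, z1)), (c, d).
  by split=> //; [apply/fiberprodP; exists g1, h1, z1 | apply/setXP].
apply: (@dcoset_inj (p, q)).
  exact: mem_dcoset Xh Yh Xa Yb ep eq.
exact: mem_dcoset Xh' Yh' Xa' Yb' ep' eq'.
Qed.

Local Notation S := (star_group X Y).

Section Modules.
Variables (M : lmodType (galg k X')) (N : lmodType (galg k Y')).

Local Notation xM i := (conj_mod (rx i) M).
Local Notation yN i := (conj_mod (ry i) N).

(** The summand of index [i], the direct sum, and the tensor product of the two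
    induced modules. *)
Definition summand (i : I) : lmodType (galg k S) :=
  Ind (sS i) (xtensor (xM i) (yN i)).

Definition source : lmodType (galg k S) := dsum summand.
Definition target : lmodType (galg k S) := xtensor (Ind sX M) (Ind sY N).

(** The linear extension of [m (x) n |-> (x (x) m) (x) (y (x) n)] to the [i]-th
    summand. *)
Definition summand_map (i : I) : summand i -> target :=
  ind_extend (N := target) (@conj_xtensor _ _ _ _ _ _ _ _ sX sY M N (rx i) (ry i)).

Lemma summand_map_linear i : linear (@summand_map i).
Proof.
apply: ind_extend_linear => [|c u t Su]; first exact: conj_xtensorB.
exact: conj_xtensorZ.
Qed.

Lemma summand_mapE i g h z (m : M) (n : N) : (g, h) \in X -> (h, z) \in Y ->
  summand_map (ind_tens (sS i) (gelt k S (g, z))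
                 (xtens (m : xM i) (n : yN i))) =
  xtens (ind_tens sX (gelt k X ((g, h) * rx i)%g) m)
        (ind_tens sY (gelt k Y ((h, z) * ry i)%g) n).
Proof.
move=> Xh Yh; rewrite [LHS]ind_extendE; first last.
- by apply/starP; exists h.
- by move=> c u t Su; apply: conj_xtensorZ.
- exact: conj_xtensorB.
rewrite conj_xtensorE // (xtensorZ _ _ Xh Yh) !ind_tensZ !gmonM // ?Xr ?Yr //.
by rewrite !mul1r.
Qed.

(** The map from the direct sum induced by the maps
    [m (x) n |-> (x (x) m) (x) (y (x) n)]. *)
Definition mackey_map : source -> target := dsum_extend summand_map.

Lemma mackey_map_linear : linear mackey_map.
Proof. exact/dsum_extend_linear/summand_map_linear. Qed.

Lemma mackey_mapE i (v : summand i) : mackey_map (dsum_in i v) = summand_map v.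
Proof. exact/dsum_extendE/summand_map_linear. Qed.

(** The element [(g, z) (x) (a m (x) b n)] of the [i]-th summand. *)
Definition decomposition_val (m : M) (n : N) (d : decomposition) : source :=
  let: (i, (g, h, z), (a, b)) := d in
  dsum_in i (ind_tens (sS i) (gelt k S (g, z))
    (xtens (gelt k X' a *: m : xM i) (gelt k Y' b *: n : yN i))).

(** The element above depends only on the pair [(p, q)] that is decomposed. *)
Lemma decomposition_val_unique p q d d' m n :
  decomposes p q d -> decomposes p q d' ->
  decomposition_val m n d = decomposition_val m n d'.
Proof.
move=> pqd pqd'; have := decomposition_index pqd pqd'; move: pqd pqd'.
case: d d' => [[i [[g h] z]] [a b]] [[i' [[g' h'] z']] [a' b']] /=.
move=> /and5P[Xh Yh Xa Yb /andP[/eqP ep /eqP eq]].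
move=> /and5P[Xh' Yh' Xa' Yb' /andP[/eqP ep' /eqP eq']] ei.
case: i' / ei ep' eq' => ep' eq'; congr (dsum_in _ _).
(* The quotient of the two fiber product parts is conjugate into [setX X' Y']. *)
pose g0 := (g'^-1 * g)%g; pose h0 := (h'^-1 * h)%g; pose z0 := (z'^-1 * z)%g.
have eX : ((g0, h0) ^ rx i = a' * a^-1)%g.
  have : ((g, h) * rx i * a = (g', h') * rx i * a')%g by rewrite -ep -ep'.
  move/(canRL (mulgK _)) => e.
  have -> : (g0, h0) = ((g', h')^-1 * (g, h))%g by [].
  by rewrite conjgE !mulgA -(mulgA _ (g, h)) e !mulgA mulgKV mulVg mul1g.
have eY : ((h0, z0) ^ ry i = b' * b^-1)%g.
  have : ((h, z) * ry i * b = (h', z') * ry i * b')%g by rewrite -eq -eq'.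
  move/(canRL (mulgK _)) => e.
  have -> : (h0, z0) = ((h', z')^-1 * (h, z))%g by [].
  by rewrite conjgE !mulgA -(mulgA _ (h, z)) e !mulgA mulgKV mulVg mul1g.
have X0 : (g0, h0) \in lconj (rx i) X' by rewrite mem_conjgV eX groupM ?groupV.
have Y0 : (h0, z0) \in lconj (ry i) Y' by rewrite mem_conjgV eY groupM ?groupV.
have S0 : (g0, z0) \in star_group (lconj (rx i) X') (lconj (ry i) Y').
  by apply/starP; exists h0.
have S' : (g', z') \in S by apply/starP; exists h'.
have -> : gelt k S (g, z) = gelt k S (g', z') * gelt k S (g0, z0).
  rewrite gmonM ?mul1r //; last by apply: (subsetP (sS i)).
  by congr (gmon _ _ _); rewrite -[RHS]/(g' * g0, z' * z0)%g !mulKVg.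
rewrite ind_tensA // (xtensorZ _ _ X0 Y0) !conj_modZ // eX eY.
rewrite !scalerA !gmonM ?groupM ?groupV //.
by rewrite !mulgKV !mul1r.
Qed.

(** The image of [(p (x) m) (x) (q (x) n)] under the inverse isomorphism.  The
    default value [0] is only taken when [p] is not in [X] or [q] is not in [Y]. *)
Definition mackey_kernel (p : gT * hT) (q : hT * kT) (m : M) (n : N) : source :=
  oapp (decomposition_val m n) 0 [pick d | decomposes p q d].

Lemma mackey_kernelE p q m n d : decomposes p q d ->
  mackey_kernel p q m n = decomposition_val m n d.
Proof.
move=> pqd; rewrite /mackey_kernel; case: pickP => [d' pqd'|/(_ d)]; last by rewrite pqd.
exact: decomposition_val_unique pqd' pqd.
Qed.

(** The inverse of [mackey_map], with
    [(p (x) m) (x) (q (x) n) |-> mackey_kernel p q m n]. *)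
Definition mackey_inv : target -> source := ind_xtensor_lift mackey_kernel.

Lemma mackey_kernelDl p q n : p \in X -> q \in Y ->
  {morph (mackey_kernel p q)^~ n : m m' / m + m'}.
Proof.
move=> Xp Yq m m'; have [d pqd] := decomposition_exists Xp Yq.
rewrite !(mackey_kernelE _ _ pqd); case: d {pqd} => [[i [[g h] z]] [a b]] /=.
rewrite -[RHS](morphBD (@dsum_inB _ _ summand i)); congr (dsum_in i _).
rewrite -[RHS]ind_tensDr; congr (ind_tens _ _ _).
by rewrite scalerDr; apply: xtensDl.
Qed.

Lemma mackey_kernelDr p q m : p \in X -> q \in Y ->
  {morph mackey_kernel p q m : n n' / n + n'}.
Proof.
move=> Xp Yq n n'; have [d pqd] := decomposition_exists Xp Yq.
rewrite !(mackey_kernelE _ _ pqd); case: d {pqd} => [[i [[g h] z]] [a b]] /=.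
rewrite -[RHS](morphBD (@dsum_inB _ _ summand i)); congr (dsum_in i _).
rewrite -[RHS]ind_tensDr; congr (ind_tens _ _ _).
by rewrite scalerDr; apply: xtensDr.
Qed.

Lemma mackey_kernelAl p q c m n : p \in X -> q \in Y -> c \in X' ->
  mackey_kernel (p * c)%g q m n = mackey_kernel p q (gelt k X' c *: m) n.
Proof.
move=> Xp Yq Xc; have [[[i [[g h] z]] [a b]] pqd] := decomposition_exists Xp Yq.
rewrite (mackey_kernelE _ _ pqd).
have /and5P[Xh Yh Xa Yb /andP[/eqP ep /eqP eq]] := pqd.
rewrite (@mackey_kernelE _ _ _ _ (i, (g, h, z), (a * c, b)%g)).
  by rewrite /decomposition_val scalerA gmonM // mul1r.
by rewrite /decomposes Xh Yh groupM // Yb ep eq mulgA !eqxx.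
Qed.

Lemma mackey_kernelAr p q c m n : p \in X -> q \in Y -> c \in Y' ->
  mackey_kernel p (q * c)%g m n = mackey_kernel p q m (gelt k Y' c *: n).
Proof.
move=> Xp Yq Yc; have [[[i [[g h] z]] [a b]] pqd] := decomposition_exists Xp Yq.
rewrite (mackey_kernelE _ _ pqd).
have /and5P[Xh Yh Xa Yb /andP[/eqP ep /eqP eq]] := pqd.
rewrite (@mackey_kernelE _ _ _ _ (i, (g, h, z), (a, b * c)%g)).
  by rewrite /decomposition_val scalerA gmonM // mul1r.
by rewrite /decomposes Xh Yh groupM // Xa ep eq mulgA !eqxx.
Qed.

Lemma mackey_kernel_scalar p q c m n : p \in X -> q \in Y ->
  mackey_kernel p q (gmon X' c 1%g *: m) n = mackey_kernel p q m (gmon Y' c 1%g *: n).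
Proof.
move=> Xp Yq; have [[[i [[g h] z]] [a b]] pqd] := decomposition_exists Xp Yq.
rewrite !(mackey_kernelE _ _ pqd); congr (dsum_in i _); congr (ind_tens _ _ _).
have /and5P[Xh Yh Xa Yb _] := pqd.
rewrite !gelt_scalarC //.
exact: conj_xtens_scalar.
Qed.

(** If [((g, h), (h, z))] is the fiber product part for [((1, v^-1) p, q)], then
    [((g, v h), (v h, z))] is the one for [(p, (v, 1) q)]: only the middle
    component changes, and the element [(g, z)] is the same. *)
Lemma mackey_kernel_balanced p q v m n : p \in X -> q \in Y -> v \in kcap X Y ->
  mackey_kernel ((1, v^-1) * p)%g q m n = mackey_kernel p ((v, 1) * q)%g m n.
Proof.
move=> Xp Yq Cv; have [_ Yv] := kcapP _ _ _ Cv; have [Xv _] := kcapP _ _ _ (groupVr Cv).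
have [[[i [[g h] z]] [a b]] pqd] := decomposition_exists (groupM Xv Xp) Yq.
have /and5P[Xh Yh Xa Yb /andP[/eqP ep /eqP eq]] := pqd.
rewrite (mackey_kernelE _ _ pqd).
rewrite (@mackey_kernelE _ _ _ _ (i, (g, v * h, z), (a, b))%g) //.
have [Xv' _] := kcapP _ _ _ Cv.
have ex : (g, v * h)%g = ((1, v) * (g, h))%g by rewrite -[RHS]/(1 * g, v * h)%g mul1g.
have ey : (v * h, z)%g = ((v, 1) * (h, z))%g by rewrite -[RHS]/(v * h, 1 * z)%g mul1g.
rewrite /decomposes ex ey !groupM // Xa Yb eq !mulgA eqxx andbT /=.
rewrite -!(mulgA (1, v)%g) -ep mulgA.
have -> : ((1, v) * (1, v^-1))%g = 1%g :> gT * hT.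
  by rewrite -[LHS]/(1 * 1, v * v^-1)%g mulg1 mulgV.
by rewrite mul1g.
Qed.

Lemma mackey_invB : {morph mackey_inv : t u / t - u}.
Proof.
exact: (ind_xtensor_liftB mackey_kernelDl mackey_kernelDr mackey_kernelAl
  mackey_kernelAr mackey_kernel_scalar mackey_kernel_balanced).
Qed.

Lemma mackey_invE p q m n : p \in X -> q \in Y ->
  mackey_inv (xtens (ind_tens sX (gelt k X p) m) (ind_tens sY (gelt k Y q) n)) =
  mackey_kernel p q m n.
Proof.
move=> Xp Yq; apply: ind_xtensor_liftE => //.
- exact: mackey_kernelDl.
- exact: mackey_kernelDr.
- exact: mackey_kernelAl.
- exact: mackey_kernelAr.
- exact: mackey_kernel_scalar.
exact: mackey_kernel_balanced.
Qed.

Lemma mackey_mapB : {morph mackey_map : s t / s - t}.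
Proof.
by move=> s t; rewrite -[- t]scaleN1r addrC mackey_map_linear scaleN1r addrC.
Qed.

Lemma source_map_eq (Z : zmodType) (f1 f2 : source -> Z) :
  {morph f1 : t u / t - u} -> {morph f2 : t u / t - u} ->
  (forall i g h z (m : M) (n : N), (g, h) \in X -> (h, z) \in Y ->
     let s := dsum_in (V := summand) i (ind_tens (sS i)
                (gelt k S (g, z)) (xtens (m : xM i) (n : yN i))) in
     f1 s = f2 s) -> f1 =1 f2.
Proof.
move=> f1B f2B f12; apply: dsum_map_eq => // i.
apply: ind_map_eq => [t s|t s|[g z] t /starP[h Xh Yh]].
- by rewrite (@dsum_inB _ _ summand) f1B.
- by rewrite (@dsum_inB _ _ summand) f2B.
move: t; apply: xtensor_map_eq => [t s|t s|m n].
- by rewrite ind_tensBr (@dsum_inB _ _ summand) f1B.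
- by rewrite ind_tensBr (@dsum_inB _ _ summand) f2B.
exact: f12 Xh Yh.
Qed.

Lemma mackey_mapK : cancel mackey_map mackey_inv.
Proof.
apply: source_map_eq => [s t|//|i g h z m n Xh Yh s].
  by rewrite mackey_mapB mackey_invB.
rewrite /s mackey_mapE (summand_mapE _ _ _ Xh Yh) mackey_invE ?groupM ?Xr ?Yr //.
(* The representative itself is decomposed with trivial parts in [X'] and [Y']. *)
rewrite (@mackey_kernelE _ _ _ _ (i, (g, h, z), (1, 1)%g)); last first.
  by rewrite /decomposes Xh Yh !group1 !mulg1 !eqxx.
rewrite /decomposition_val -[gelt k X' _]/(1 : galg k X') -[gelt k Y' _]/(1 : galg k Y').
by rewrite !scale1r.
Qed.

Lemma mackey_invK : cancel mackey_inv mackey_map.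
Proof.
apply: ind_xtensor_map_eq => [t u|//|p q m n Xp Yq].
  by rewrite mackey_invB mackey_mapB.
rewrite mackey_invE //.
have [[[i [[g h] z]] [a b]] pqd] := decomposition_exists Xp Yq.
have /and5P[Xh Yh Xa Yb /andP[/eqP ep /eqP eq]] := pqd.
rewrite (mackey_kernelE _ _ pqd) [LHS]mackey_mapE (summand_mapE _ _ _ Xh Yh).
have Xhx := groupM Xh (Xr i); have Yhy := groupM Yh (Yr i).
have Xa1 := subsetP sX a Xa; have Yb1 := subsetP sY b Yb.
by rewrite -!ind_tensA // !gmonM // !mul1r -ep -eq.
Qed.

Lemma mackey_inv_linear : linear mackey_inv.
Proof.
move=> a t u; apply: (can_inj mackey_mapK).
by rewrite mackey_map_linear !mackey_invK.
Qed.

End Modules.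

Local Notation modX' := (mod_cat (galg k X')).
Local Notation modY' := (mod_cat (galg k Y')).

Definition summand_functor (i : I) :
    functor (prod_cat modX' modY') (mod_cat (galg k S)) :=
  comp_functor (Ind_functor k (sS i))
    (comp_functor (xtensor_functor k (lconj (rx i) X') (lconj (ry i) Y'))
      (prod_functor (conj_functor k (rx i) X') (conj_functor k (ry i) Y'))).

(** The direct sum as a functor of the pair [(M, N)], built from the summands. *)
Definition source_functor : functor (prod_cat modX' modY') (mod_cat (galg k S)) :=
  dsum_functor summand_functor.

Definition mackey_hom (a : prod_cat modX' modY') :
    Defs.hom (source_functor a) (mackey_lhs k sX sY a) :=
  let: (M, N) as a' := a return Defs.hom (source_functor a') (mackey_lhs k sX sY a') in
  linear_of (@mackey_map_linear M N).

Definition mackey_hom_inv (a : prod_cat modX' modY') :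
    Defs.hom (mackey_lhs k sX sY a) (source_functor a) :=
  let: (M, N) as a' := a return Defs.hom (mackey_lhs k sX sY a') (source_functor a') in
  linear_of (@mackey_inv_linear M N).

Lemma mackey_hom_natural (a b : prod_cat modX' modY') (f : Defs.hom a b) :
  Defs.comp (mackey_hom b) (fmap source_functor f) =
  Defs.comp (fmap (mackey_lhs k sX sY) f) (mackey_hom a).
Proof.
case: a b f => [M N] [M' N'] [f1 f2].
pose f12 : Defs.hom ((M, N) : prod_cat modX' modY') (M', N') := (f1, f2).
apply: linear_eq; apply: source_map_eq => [s t|s t|i g h z m n Xh Yh s].
- exact: raddfB.
- exact: raddfB.
have fsE : (fmap source_functor f12 : {linear _ -> _}) s =
    dsum_in (V := summand M' N') i (ind_tens (sS i) (gelt k S (g, z))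
      (xtens (f1 m : conj_mod (rx i) M') (f2 n : conj_mod (ry i) N'))).
  rewrite /s [LHS]dsum_map_in; congr (dsum_in i _).
  rewrite [LHS]ext_mapE; congr (ind_tens _ _ _).
  exact: xtensor_mapE.
rewrite [LHS](congr1 (@mackey_map M' N') fsE) mackey_mapE (summand_mapE _ _ _ Xh Yh).
rewrite -[RHS]/((fmap (mackey_lhs k sX sY) _ : {linear _ -> _}) (mackey_map s)).
rewrite /s mackey_mapE (summand_mapE _ _ _ Xh Yh).
symmetry; rewrite [LHS]xtensor_mapE; congr (xtens _ _); exact: ext_mapE.
Qed.

Definition mackey_iso : nat_iso source_functor (mackey_lhs k sX sY).
Proof.
refine (@NatIso _ _ _ _ mackey_hom mackey_hom_inv mackey_hom_natural _ _) => -[M N].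
  by apply: linear_eq => t; apply: mackey_invK.
by apply: linear_eq => s; apply: mackey_mapK.
Defined.

Lemma mackey_isoE (M : lmodType (galg k X')) (N : lmodType (galg k Y')) i
    (m : M) (n : N) :
  mackey_iso (M, N)
    (dsum_in (V := fun j => summand_functor j ((M, N) : prod_cat modX' modY')) i
      (ind_tens (sS i) 1 (xtens (m : conj_mod (rx i) M) (n : conj_mod (ry i) N)))) =
  xtens (ind_tens sX (gelt k X (rx i)) m) (ind_tens sY (gelt k Y (ry i)) n).
Proof.
rewrite -[LHS]/(mackey_map (dsum_in (V := summand M N) i
  (ind_tens (sS i) (gelt k S (1, 1)%g)
    (xtens (m : conj_mod (rx i) M) (n : conj_mod (ry i) N))))).
rewrite mackey_mapE (@summand_mapE _ _ _ 1%g 1%g 1%g) ?(group1 X) ?(group1 Y) //.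
by rewrite !mul1g.
Qed.

End MackeyDecomposition.

Theorem theorem3p5 (k : comPzRingType) (gT hT kT : finGroupType)
    (X X' : {group gT * hT}) (Y Y' : {group hT * kT})
    (sX : X' \subset X) (sY : Y' \subset Y)
    (R : {set (gT * hT) * (hT * kT)})
    (hR : is_transversal R
            (double_cosets (fiberprod X Y) (setX X Y) (setX X' Y')) (setX X Y)) :
  exists Phi : nat_iso (mackey_rhs k sX sY (transversal_sub hR))
                       (mackey_lhs k sX sY),
    forall (M : lmodType (galg k X')) (N : lmodType (galg k Y'))
           (i : {z | z \in R}) (m : M) (n : N),
      let x := (val i).1 in
      let y := (val i).2 in
      Phi (M, N) (mackey_in sX sY (transversal_sub hR) i
                    (xtens (m : conj_mod x M) (n : conj_mod y N))) =
      xtens (ind_tens sX (gelt k X x) m) (ind_tens sY (gelt k Y y) n).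
Proof.
have XYr (i : {z | z \in R}) : ((val i).1, (val i).2) \in setX X Y.
  by rewrite -surjective_pairing; apply: (subsetP (transversal_sub hR)) (valP i).
have Xr (i : {z | z \in R}) : (val i).1 \in X by case/setXP: (XYr i).
have Yr (i : {z | z \in R}) : (val i).2 \in Y by case/setXP: (XYr i).
have cover u : u \in setX X Y -> exists i : {z | z \in R},
    u \in (fiberprod_group X Y :* ((val i).1, (val i).2) * setX_group X' Y')%g.
  move=> XYu.
  have [r Rr ur] := transversal_dcoset (A := fiberprod_group X Y)
    (B := setX_group X' Y') hR XYu.
  by exists (Sub r Rr); rewrite -surjective_pairing.
have inj u (i j : {z | z \in R}) :
    u \in (fiberprod_group X Y :* ((val i).1, (val i).2) * setX_group X' Y')%g ->
    u \in (fiberprod_group X Y :* ((val j).1, (val j).2) * setX_group X' Y')%g ->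
    i = j.
  rewrite -!surjective_pairing => ui uj; apply: val_inj.
  exact: (transversal_dcoset_inj (A := fiberprod_group X Y)
    (B := setX_group X' Y') hR (valP i) (valP j) ui uj).
exists (mackey_iso k sX sY Xr Yr (star_lconjS sX sY (transversal_sub hR)) cover inj).
move=> M N i m n x y.
exact: mackey_isoE.
Qed.
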